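(* Let $H$ be an infinite-dimensional complex Hilbert space, let $B(H)$ be the algebra of all bounded linear operators on $H$, and let $\varepsilon>0$ be fixed. Suppose that a bijective map $\varphi: B(H)\to B(H)$ (no linearity or continuity is assumed) satisfies $$\sigma_{\varepsilon}([T_{1}\bullet T_{2},T_{3}]_{\ast})=\sigma_{\varepsilon}([\varphi(T_{1})\bullet \varphi(T_{2}),\varphi(T_{3})]_{\ast})\qquad\text{for all } T_{1},T_{2},T_{3}\in B(H),$$ where $[T_1\bullet T_2,T_3]_\ast=(T_1T_2+T_2T_1^\ast)T_3-T_3(T_1T_2+T_2T_1^\ast)^\ast$. Then there exist an invertible operator $S\in B(H)$ and a unitary operator $U\in B(H)$ such that either $\varphi(T)=SUTU^{\ast}$ for every $T\in B(H)$, or $\varphi(T)=SUT^{t}U^{\ast}$ for every $T\in B(H)$.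
   Context: For $T,S\in B(H)$, $T^\ast$ denotes the adjoint of $T$, $T\bullet S=TS+ST^{\ast}$ is the Jordan $\ast$-product, and $[T,S]_{\ast}=TS-ST^{\ast}$ is the skew Lie product. $T^{t}$ denotes the transpose of $T$ relative to an arbitrary but fixed orthonormal basis of $H$, i.e. $T^t=JT^\ast J$ where $J$ is the conjugate-linear map fixing each vector of that basis. $\sigma(T)$ denotes the spectrum of $T$. For fixed $\varepsilon>0$, the $\varepsilon$-pseudo spectrum of $T$ is $$\sigma_{\varepsilon}(T)=\bigcup\{\sigma(T+A): A\in B(H),\ \|A\|\le\varepsilon\}=\{\lambda\in\mathbb{C}: \|(\lambda I-T)^{-1}\|\ge \varepsilon^{-1}\},$$ with the convention $\|(\lambda I-T)^{-1}\|=\infty$ if $\lambda\in\sigma(T)$. *)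

(* Defs.v *)
From HB Require Import structures.
From mathcomp Require Import all_boot all_order all_algebra.
From mathcomp Require Import sesquilinear complex.
From mathcomp Require Import all_classical all_reals all_analysis.
From mathcomp Require Import ring lra.

Set Implicit Arguments.
Unset Strict Implicit.
Unset Printing Implicit Defensive.

Import Order.TTheory GRing.Theory Num.Theory.
Import numFieldNormedType.Exports.

Local Open Scope classical_set_scope.
Local Open Scope complex_scope.
Local Open Scope ring_scope.

HB.mixin Record CompleteNormedModule_isHilbert (R : realType) H
    of CompleteNormedModule R[i] H := {
  inner_subproof : {dot H for Num.conj} ;
  normr_inner_subproof : forall x : H, `|x| ^+ 2 = inner_subproof x x
}.

#[short(type="hilbertType")]
HB.structure Definition Hilbert (R : realType) :=
  {H of CompleteNormedModule R[i] H & CompleteNormedModule_isHilbert R H}.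

Definition inner (R : realType) (H : hilbertType R) : {dot H for Num.conj} :=
  inner_subproof.

Notation "''<' x , y >" := (inner _ x y)
  (at level 0, x, y at level 69, format "''<' x ,  y >") : ring_scope.

Section RealNorm.
Context {R : realType} {H : hilbertType R}.
Implicit Types (x y : H) (a : R[i]).

(* The library norm of a normed module over R[i] takes its values in R[i]. *)
Definition rnorm (x : H) : R := complex.Re `|x|.

Lemma rnormE x : (rnorm x)%:C = `|x|.
Proof. by rewrite /rnorm RRe_real ?normr_real. Qed.

Lemma rnorm_ge0 x : 0 <= rnorm x.
Proof. by rewrite -ler0c rnormE normr_ge0. Qed.

Lemma rnorm_eq0 x : (rnorm x == 0) = (x == 0).
Proof. by rewrite -(normr_eq0 x) -rnormE -[0 in RHS]/(0%:C) (inj_eq (@complexI _)). Qed.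

Lemma rnorm0 : rnorm 0 = 0. Proof. by apply/eqP; rewrite rnorm_eq0. Qed.

Lemma rnormD x y : rnorm (x + y) <= rnorm x + rnorm y.
Proof. by rewrite -lecR rmorphD /= !rnormE ler_normD. Qed.

Lemma rnormZ a x : rnorm (a *: x) = complex.Re `|a| * rnorm x.
Proof.
by apply: (@complexI R); rewrite rmorphM /= !rnormE normrZ.
Qed.

Lemma rnormN x : rnorm (- x) = rnorm x.
Proof. by rewrite /rnorm normrN. Qed.

Lemma rnormB x y : rnorm (x - y) <= rnorm x + rnorm y.
Proof. by rewrite -(rnormN y) rnormD. Qed.

Lemma rnorm_sq x : (rnorm x ^+ 2)%:C = '<x, x>.
Proof. by rewrite rmorphXn /= rnormE normr_inner_subproof. Qed.

Lemma innerC x y : '<x, y> = Num.conj '<y, x>.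
Proof. by rewrite (hermC (inner H)) expr0 mul1r. Qed.

Lemma inner_parallelogram x y :
  rnorm (x + y) ^+ 2 + rnorm (x - y) ^+ 2 = (rnorm x ^+ 2 + rnorm y ^+ 2) *+ 2.
Proof.
apply: (@complexI R); rewrite rmorphMn !rmorphD /= !rnorm_sq dnormD dnormB.
by rewrite addrACA subrr addr0 mulr2n.
Qed.

Lemma inner_CauchySchwarz x y : `|'<x, y>| <= `|x| * `|y|.
Proof.
have [->|y0] := eqVneq y 0; first by rewrite linear0r !normr0 mulr0.
rewrite -(@ler_pXn2r _ 2) ?nnegrE ?mulr_ge0 //.
have ny0 : 0 < '<y, y> by rewrite dnorm_gt0.
have := dnorm_ge0 (inner H) ('<y, y> *: x - '<x, y> *: y).
rewrite dnormB !dnormZ linearZl_LR linearZr_LR /=.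
rewrite (ger0_norm (ltW ny0)) exprMn !normr_inner_subproof -!/(inner H) !normCK.
set p := '<x, x>; set q := '<y, y>; set c := '<x, y>.
have qR : Num.conj q = q by rewrite -innerC.
have pR : Num.conj p = p by rewrite -innerC.
rewrite !rmorphM /= conjCK qR.
have -> : q ^+ 2 * p + c * Num.conj c * q -
  (q * (Num.conj c * c) + q * (c * Num.conj c))
  = q * (p * q - c * Num.conj c) by ring.
by rewrite pmulr_rge0 // subr_ge0.
Qed.

End RealNorm.

Section Riesz.
Context {R : realType} {H : hilbertType R}.

Lemma Riesz_representation (g : {scalar H}) (M : R) :
  0 <= M -> (forall x, complex.Re `|g x| <= M * rnorm x) ->
  exists z, forall x, g x = '<x, z>.
Proof.
move=> M0 gM.
have gMC x : `|g x| <= M%:C * `|x|.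
  by rewrite -rnormE -rmorphM /= -(RRe_real (normr_real (g x))) lecR.
have [g0|/existsNP[w /eqP gw]] := pselect (forall x, g x = 0).
  by exists 0 => x; rewrite g0 linear0r.
pose K := [set x | g x = 1].
pose w1 := (g w)^-1 *: w.
have Kw1 : K w1 by rewrite /K /= linearZ /= mulVf.
pose d := inf [set rnorm x | x in K].
have K_lb : has_inf [set rnorm x | x in K].
  split; first by exists (rnorm w1), w1.
  by exists 0 => _ [x _ <-]; exact: rnorm_ge0.
have d_le x : K x -> d <= rnorm x.
  by move=> Kx; apply: ge_inf; [case: K_lb | exists x].
have d0 : 0 <= d by apply: lb_le_inf; [case: K_lb|move=> _ [x _ <-]; exact: rnorm_ge0].
pose Ke (e : R) := [set x | K x /\ rnorm x < d + e].
have Ke_ex e : 0 < e -> Ke e !=set0.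
  move=> e0; have [_ [x Kx <-] xe] := inf_adherent e0 K_lb.
  by exists x.
have Ke_sub e e' : e <= e' -> Ke e `<=` Ke e'.
  by move=> ee' x [Kx xe]; split=> //; apply: lt_le_trans xe _; rewrite lerD2l.
pose F := filter_from [set e : R | 0 < e] Ke.
have FF : ProperFilter F.
  apply: filter_from_proper; last by move=> e /= /Ke_ex.
  apply: filter_from_filter; first by exists 1 => /=.
  move=> e e' /= e0 e'0; exists (Num.min e e'); first by rewrite lt_min e0.
  by move=> x Kx; split; apply: Ke_sub Kx; rewrite ge_min lexx ?orbT.
have Ke_dist e x y : 0 < e -> Ke e x -> Ke e y ->
    rnorm (x - y) ^+ 2 <= (d * e *+ 2 + e ^+ 2) *+ 4.
  move=> e0 [Kx xe] [Ky ye].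
  have xy : d *+ 2 <= rnorm (x + y).
    have /d_le : K (2^-1 *: (x + y)).
      by rewrite /K /= linearZ linearD /= Kx Ky; apply: mulVf; rewrite pnatr_eq0.
    rewrite -(ler_pMn2r (n := 2)) //; congr (_ <= _).
    rewrite -[LHS]mulr_natl; apply: (@complexI R).
    rewrite rmorphM /= !rnormE normrZ rmorph_nat normfV normr_nat mulrA.
    by rewrite mulfV ?mul1r // pnatr_eq0.
  have := inner_parallelogram x y.
  have := rnorm_ge0 x; have := rnorm_ge0 y.
  move: xe ye xy; move: (rnorm x) (rnorm y) (rnorm (x+y)) (rnorm (x-y)).
  move=> a b s t ae be ds b0 a0 pE.
  have a2 : a ^+ 2 <= (d + e) ^+ 2 by rewrite ler_sqr ?nnegrE; lra.
  have b2 : b ^+ 2 <= (d + e) ^+ 2 by rewrite ler_sqr ?nnegrE; lra.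
  have s2 : (d *+ 2) ^+ 2 <= s ^+ 2 by rewrite ler_sqr ?nnegrE; lra.
  by move: a2 b2 s2 pE; rewrite !expr2; nra.
have : cauchy F.
  apply: cauchy_exP => r r0.
  have [r1 [r10 r1E]] : exists r1 : R, 0 < r1 /\ r1%:C = r.
    exists (complex.Re r); have rE : (complex.Re r)%:C = r by rewrite RRe_real ?gtr0_real.
    by rewrite -(ltcR 0) rE.
  pose e := Num.min 1 (r1 ^+ 2 / (d *+ 2 + 1) / 5).
  have q0 : 0 < r1 ^+ 2 / (d *+ 2 + 1) / 5.
    by rewrite !divr_gt0 ?exprn_gt0 // ltr_wpDl // mulrn_wge0.
  have e0 : 0 < e by rewrite lt_min ltr01.
  have [x Kx] := Ke_ex _ e0; exists x; exists e => // y Ky.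
  rewrite -ball_normE /= -r1E -rnormE ltcR.
  rewrite -(ltr_pXn2r (n := 2)) ?nnegrE ?rnorm_ge0 ?(ltW r10) //.
  apply: le_lt_trans (Ke_dist _ _ _ e0 Kx Ky) _.
  have e1 : e <= 1 by rewrite ge_min lexx.
  have : e <= r1 ^+ 2 / (d *+ 2 + 1) / 5 by rewrite ge_min lexx orbT.
  rewrite !ler_pdivlMr ?ltr0n //; last by rewrite ltr_wpDl // mulrn_wge0.
  have : 0 < r1 ^+ 2 by rewrite exprn_gt0.
  move: (r1 ^+ 2) => u u0 eu; clearbody e; rewrite expr2; nra.
move=> /cauchy_cvg /cvg_ex [z Fz].
have zP e : 0 < e -> exists2 x, Ke e x & rnorm (z - x) < e.
  move=> e0.
  have : F (Ke e `&` ball z e%:C).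
    apply: filterI; first by exists e.
    by apply: Fz; apply: nbhsx_ballx; rewrite (ltcR 0).
  move=> /filter_ex [x [Kx]]; rewrite -ball_normE /= -rnormE ltcR => zx.
  by exists x.
have gz : g z = 1.
  apply/eqP; rewrite -subr_eq0 -normr_eq0 -(RRe_real (normr_real _)).
  apply/eqP; congr (_%:C); apply/eqP; rewrite eq_le; apply/andP; split; last first.
    by rewrite -ler0c RRe_real ?normr_real.
  apply/ler_addgt0Pr => e e0; rewrite add0r.
  have eM : 0 < e / (M + 1) by rewrite divr_gt0 // ltr_wpDl.
  have [x [<- _] zx] := zP _ eM.
  rewrite -linearB; apply: le_trans (gM _) _.
  apply: le_trans (_ : (M + 1) * (e / (M + 1)) <= _).
    by apply: ler_pM => //; rewrite ?rnorm_ge0 // ?ltW // ltrDl.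
  by rewrite mulrC divfK // gt_eqF // ltr_wpDl.
have zd : rnorm z <= d.
  apply/ler_addgt0Pr => e e0.
  have e2 : 0 < e / 2 by rewrite divr_gt0.
  have [x [_ xe] zx] := zP _ e2.
  have := rnormD (z - x) x; rewrite subrK.
  by move: xe zx; lra.
have gker h : g h = 0 -> '<h, z> = 0.
  move=> gh.
  have [->|h0] := eqVneq h 0; first by rewrite linear0l.
  have hh0 : 0 < '<h, h> by rewrite dnorm_gt0.
  pose t := '<z, h> / '<h, h>.
  have : '<z, z> <= '<z - t *: h, z - t *: h>.
    rewrite -!rnorm_sq lecR ler_sqr ?nnegrE ?rnorm_ge0 //.
    apply: le_trans zd _; apply: d_le.
    by rewrite /K /= linearB linearZ /= gh mulr0 subr0.
  rewrite dnormB dnormZ linearZr_LR /= normCK /t rmorphM /= fmorphV /= -(innerC h h).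
  rewrite -(innerC h z).
  have -> : '<z, z> + '<z, h> / '<h, h> * ('<h, z> / '<h, h>) * '<h, h>
     - ('<h, z> / '<h, h> * '<z, h> + Num.conj ('<h, z> / '<h, h> * '<z, h>))
    = '<z, z> - '<h, z> * '<z, h> / '<h, h>.
    rewrite !rmorphM /= fmorphV /= -(innerC h h) -(innerC z h) -(innerC h z).
    by field; rewrite gt_eqF.
  rewrite lerBrDl gerDr pmulr_lle0 ?invr_gt0 // (innerC z h) -normCK.
  move=> n0; apply/eqP; rewrite -normr_eq0 -sqrf_eq0 eq_le n0.
  by rewrite exprn_ge0.
have z0 : '<z, z> != 0.
  rewrite dnorm_eq0; apply/eqP => z0.
  by move: gz; rewrite z0 linear0 => /eqP; rewrite eq_sym oner_eq0.
exists ('<z, z>^-1 *: z) => x.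
have : '<x - g x *: z, z> = 0.
  by apply: gker; rewrite linearB linearZ /= gz mulr1 subrr.
rewrite linearBl linearZl_LR /= => /eqP; rewrite subr_eq0 => /eqP xz.
by rewrite linearZr_LR /= fmorphV /= -(innerC z z) xz mulrC mulfK.
Qed.

End Riesz.

Definition bounded_map (R : realType) (H : hilbertType R) (f : H -> H) :=
  exists2 M : R, 0 <= M & forall x, rnorm (f x) <= M * rnorm x.

Record bop (R : realType) (H : hilbertType R) := BOp {
  bop_fun :> H -> H ;
  bop_linear : linear bop_fun ;
  bop_bounded : bounded_map bop_fun
}.

Notation "''B' ( H )" := (bop H) (at level 8, format "''B' ( H )") : type_scope.

HB.instance Definition _ (R : realType) (H : hilbertType R) (T : 'B(H)) :=
  GRing.isLinear.Build R[i] H H *:%R (bop_fun T) (@bop_linear R H T).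
HB.instance Definition _ (R : realType) (H : hilbertType R) :=
  gen_eqMixin 'B(H).
HB.instance Definition _ (R : realType) (H : hilbertType R) :=
  gen_choiceMixin 'B(H).

Section BoundedOperators.
Context {R : realType} {H : hilbertType R}.
Implicit Types (S T : 'B(H)) (a : R[i]).

Lemma bopP S T : (forall x, S x = T x) -> S = T.
Proof.
case: S T => [f fl fb] [g gl gb] /= /funext fg; move: fl fb gl gb.
by rewrite fg => *; congr BOp; exact: Prop_irrelevance.
Qed.

Lemma bounded_map_comp (f g : H -> H) :
  bounded_map f -> bounded_map g -> bounded_map (f \o g).
Proof.
move=> [M M0 fM] [N N0 gN]; exists (M * N); first exact: mulr_ge0.
by move=> x; apply: le_trans (fM _) _; rewrite -mulrA ler_wpM2l.
Qed.

Fact zero_linear : linear (fun _ : H => 0 : H).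
Proof. by move=> a x y; rewrite scaler0 addr0. Qed.
Fact zero_bounded : bounded_map (fun _ : H => 0 : H).
Proof. by exists 0 => // x; rewrite rnorm0 mul0r. Qed.
Definition bop0 := BOp zero_linear zero_bounded.

Fact one_linear : linear (@id H). Proof. by []. Qed.
Fact one_bounded : bounded_map (@id H).
Proof. by exists 1 => // x; rewrite mul1r. Qed.
Definition bop1 := BOp one_linear one_bounded.

Fact opp_linear T : linear (fun x => - T x).
Proof. by move=> a x y; rewrite linearP opprD scalerN. Qed.
Fact opp_bounded T : bounded_map (fun x => - T x).
Proof. by have [M M0 TM] := bop_bounded T; exists M => // x; rewrite rnormN. Qed.
Definition bop_opp T := BOp (opp_linear T) (opp_bounded T).

Fact add_linear S T : linear (fun x => S x + T x).
Proof. by move=> a x y; rewrite !linearP scalerDr addrACA. Qed.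
Fact add_bounded S T : bounded_map (fun x => S x + T x).
Proof.
have [M M0 SM] := bop_bounded S; have [N N0 TN] := bop_bounded T.
exists (M + N); first exact: addr_ge0.
by move=> x; rewrite mulrDl; apply: le_trans (rnormD _ _) _; exact: lerD.
Qed.
Definition bop_add S T := BOp (add_linear S T) (add_bounded S T).

Fact scale_linear a T : linear (fun x => a *: T x).
Proof. by move=> b x y; rewrite linearP scalerDr !scalerA mulrC. Qed.
Fact scale_bounded a T : bounded_map (fun x => a *: T x).
Proof.
have [M M0 TM] := bop_bounded T; have a0 : 0 <= complex.Re `|a|.
  by rewrite -ler0c RRe_real ?normr_real.
exists (complex.Re `|a| * M); first exact: mulr_ge0.
by move=> x; rewrite rnormZ -mulrA ler_wpM2l.
Qed.
Definition bop_scale a T := BOp (scale_linear a T) (scale_bounded a T).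

Fact comp_linear S T : linear (S \o T).
Proof. by move=> a x y /=; rewrite !linearP. Qed.
Definition bop_mul S T :=
  BOp (comp_linear S T) (bounded_map_comp (bop_bounded S) (bop_bounded T)).

Fact bop_addA : associative bop_add.
Proof. by move=> S T U; apply: bopP => x /=; rewrite addrA. Qed.
Fact bop_addC : commutative bop_add.
Proof. by move=> S T; apply: bopP => x /=; rewrite addrC. Qed.
Fact bop_add0 : left_id bop0 bop_add.
Proof. by move=> S; apply: bopP => x /=; rewrite add0r. Qed.
Fact bop_addN : left_inverse bop0 bop_opp bop_add.
Proof. by move=> S; apply: bopP => x /=; rewrite addNr. Qed.

HB.instance Definition _ :=
  GRing.isZmodule.Build 'B(H) bop_addA bop_addC bop_add0 bop_addN.

Fact bop_mulA : associative bop_mul.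
Proof. by move=> S T U; apply: bopP. Qed.
Fact bop_mul1l : left_id bop1 bop_mul.
Proof. by move=> S; apply: bopP. Qed.
Fact bop_mul1r : right_id bop1 bop_mul.
Proof. by move=> S; apply: bopP. Qed.
Fact bop_mulDl : left_distributive bop_mul bop_add.
Proof. by move=> S T U; apply: bopP. Qed.
Fact bop_mulDr : right_distributive bop_mul bop_add.
Proof. by move=> S T U; apply: bopP => x /=; rewrite linearD. Qed.

(* Not a nonzero ring: 0 = 1 when H is the zero space. *)
HB.instance Definition _ := GRing.Zmodule_isPzRing.Build 'B(H)
  bop_mulA bop_mul1l bop_mul1r bop_mulDl bop_mulDr.

Fact bop_scaleA a b T : bop_scale a (bop_scale b T) = bop_scale (a * b) T.
Proof. by apply: bopP => x /=; rewrite scalerA. Qed.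
Fact bop_scale1 : left_id 1 bop_scale.
Proof. by move=> T; apply: bopP => x /=; rewrite scale1r. Qed.
Fact bop_scaleDr : right_distributive bop_scale +%R.
Proof. by move=> a S T; apply: bopP => x /=; rewrite scalerDr. Qed.
Fact bop_scaleDl T : {morph bop_scale^~ T : a b / a + b}.
Proof. by move=> a b; apply: bopP => x /=; rewrite scalerDl. Qed.

HB.instance Definition _ := GRing.Zmodule_isLmodule.Build R[i] 'B(H)
  bop_scaleA bop_scale1 bop_scaleDr bop_scaleDl.

Lemma bop0E x : (0 : 'B(H)) x = 0. Proof. by []. Qed.
Lemma bop1E x : (1 : 'B(H)) x = x. Proof. by []. Qed.
Lemma bopNE T x : (- T) x = - T x. Proof. by []. Qed.
Lemma bopDE S T x : (S + T) x = S x + T x. Proof. by []. Qed.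
Lemma bopME S T x : (S * T) x = S (T x). Proof. by []. Qed.
Lemma bopZE a T x : (a *: T) x = a *: T x. Proof. by []. Qed.
Definition bopE := (bop0E, bop1E, bopNE, bopDE, bopME, bopZE).

Definition opnorm T : R := sup [set rnorm (T x) | x in [set x | rnorm x <= 1]].

Definition bop_invertible T := exists S : 'B(H), S * T = 1 /\ T * S = 1.

Definition spectrum T : set R[i] := 
  [set l : R[i] | ~ bop_invertible (l *: (1 : 'B(H)) - T)].

Definition pseudospectrum (eps : R) T : set R[i] :=
  \bigcup_(A in [set A : 'B(H) | opnorm A <= eps]) spectrum (T + A).

Lemma adjoint_ex T : exists S : 'B(H), forall x y, '<T x, y> = '<x, S y>.
Proof.
have [M M0 TM] := bop_bounded T.
have riesz y : exists z, forall x, '<T x, y> = '<x, z>.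
  pose g x := '<T x, y>.
  have g_lin : scalar g by move=> a u v; rewrite /g linearP linearPl.
  pose gL : {scalar H} := HB.pack g (GRing.isLinear.Build _ _ _ _ g g_lin).
  apply: (@Riesz_representation R H gL (M * rnorm y)) => [|x].
    by rewrite mulr_ge0 ?rnorm_ge0.
  rewrite -lecR RRe_real ?normr_real //.
  apply: le_trans (inner_CauchySchwarz _ _) _.
  by rewrite -!rnormE -rmorphM lecR /= mulrAC ler_wpM2r ?rnorm_ge0.
have [S ST] := choice riesz.
have inner_inj (u v : H) : (forall x, '<x, u> = '<x, v>) -> u = v.
  move=> uv; apply/eqP; rewrite -subr_eq0 -(dnorm_eq0 (inner H)).
  by rewrite linearBr /= uv subrr.
have S_lin : linear S.
  move=> a u v; apply: inner_inj => x.
  by rewrite -ST !linearDr !linearZr_LR /= !ST.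
have S_bnd : bounded_map S.
  exists M => // y; have [->|] := eqVneq (S y) 0.
    by rewrite rnorm0 mulr_ge0 ?rnorm_ge0.
  rewrite -rnorm_eq0 => Sy0; have Sy1 : 0 < rnorm (S y).
    by rewrite lt_def Sy0 rnorm_ge0.
  rewrite -(ler_pM2l Sy1) -expr2 -lecR.
  have -> : (rnorm (S y) ^+ 2)%:C = `|'<T (S y), y>|.
    by rewrite ST -rnorm_sq ger0_norm // ler0c sqr_ge0.
  apply: le_trans (inner_CauchySchwarz _ _) _.
  rewrite -!rnormE -rmorphM lecR /= mulrA ler_wpM2r ?rnorm_ge0 //.
  by rewrite mulrC.
by exists (BOp S_lin S_bnd).
Qed.

Definition adjoint T : 'B(H) := sval (cid (adjoint_ex T)).

Lemma adjointP T x y : '<T x, y> = '<x, adjoint T y>.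
Proof. exact: (svalP (cid (adjoint_ex T))). Qed.

End BoundedOperators.

Section Products.
Context {R : realType} {H : hilbertType R}.
Implicit Types (S T U : 'B(H)).

Definition unitary U := adjoint U * U = 1 /\ U * adjoint U = 1.

Definition jordan_star T S : 'B(H) := T * S + S * adjoint T.

Definition skew_lie T S : 'B(H) := T * S - S * adjoint T.

End Products.

Section Bases.
Context {R : realType} {H : hilbertType R}.
Implicit Types (E : set H).

Definition lin_span E : set H :=
  [set x | exists (s : seq H) (c : H -> R[i]),
    (forall e, e \in s -> E e) /\ x = \sum_(e <- s) c e *: e].

Definition orthonormal_basis E :=
  [/\ forall e, E e -> '<e, e> = 1,
      forall e f, E e -> E f -> e <> f -> '<e, f> = 0
    & closure (lin_span E) = setT].

(* Boundedness is what makes the conjugate-linear map fixing the basis unique: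
   it is the map \sum_e c_e e |-> \sum_e c_e^* e on (infinite) expansions. *)
Record basis_conj E := BasisConj {
  basis_conj_fun :> H -> H ;
  basis_conj_linear : GRing.linear_for (Num.conj \; *:%R) basis_conj_fun ;
  basis_conj_bounded : bounded_map basis_conj_fun ;
  basis_conj_fix : forall e, E e -> basis_conj_fun e = e
}.

Section Transpose.
Context {E : set H} (J : basis_conj E).

Fact transpose_linear (T : 'B(H)) : linear (fun x => J (adjoint T (J x))).
Proof.
move=> a x y.
by rewrite basis_conj_linear /= linearP basis_conj_linear /= conjCK.
Qed.

Fact transpose_bounded (T : 'B(H)) :
  bounded_map (fun x => J (adjoint T (J x))).
Proof.
have Jb := basis_conj_bounded J.
exact: (bounded_map_comp Jb (bounded_map_comp (bop_bounded (adjoint T)) Jb)).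
Qed.

Definition transpose (T : 'B(H)) : 'B(H) :=
  BOp (transpose_linear T) (transpose_bounded T).

End Transpose.
End Bases.

Definition infinite_dimensional (R : realType) (H : hilbertType R) :=
  forall s : seq H, lin_span [set` s] <> setT.

(* Main.v *)
Require Import Defs.
From mathcomp Require Import all_boot all_order all_algebra.
From mathcomp Require Import sesquilinear complex.
From mathcomp Require Import all_classical all_reals all_analysis.
From mathcomp Require Import ring lra.
Import Order.TTheory GRing.Theory Num.Theory.
Import numFieldNormedType.Exports.
Local Open Scope classical_set_scope.
Local Open Scope complex_scope.
Local Open Scope ring_scope.

(** Write F(A, B, C) for [skew_lie (jordan_star A B) C] and adj A for the adjoint
    of A. The map phi turns out to be a *-automorphism of B(H),
    hence of the form T |-> U T (adj U) with U unitary; so the first alternative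
    holds, with S = 1. No spectral theorem and no Wigner-type theorem is used,
    because pseudospectra are only read off through two elementary facts.

    - For X self-adjoint and c a complex number of modulus 1, the pseudospectrum
      of c X determines the supremum of the numerical range of X
      ([eq_pseudospectrum_num_le]). Coercive operators are invertible, which
      bounds the pseudospectrum; conversely the supremum is an approximate
      eigenvalue of X, and perturbing X by eps shifts it by eps.
    - If t X has the same pseudospectrum as 0 for every real t > 0, then X = 0
      ([eq0_of_pseudospectrum]). Since F is real-homogeneous in its first slot and
      phi is onto, identities of the form F(A, B, C) = 0 for all A are therefore
      preserved ([preserver_left_annihilator]).

    For B and C nonzero, F(., B, C) vanishes identically exactly when B is
    self-adjoint and C is scalar. So phi maps self-adjoint operators to
    self-adjoint operators and scalars to scalars, and the values of F on scalars
    then force phi(1) = 1 and phi(i) = i ([preserver_1_i]). From here F gives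
    commutators, anticommutators and numerical ranges of self-adjoint operators:
    products equal to 0 are preserved, and the rank-one projections, being
    characterised by minimality in terms of such products ([atom]), are permuted
    by phi, with phi(i P) = i phi(P) ([preserver_i_rank1]).

    Let P be the projection onto the line of a unit vector x and phi(P) the one
    onto the line of x'. Then F(A, i P, 1) = 2i (A P + P (adj A)) and F(P, A, 1)
    are multiples of self-adjoint operators of rank at most two, whose numerical
    ranges can be computed. Comparing them with the images under phi gives
    <phi(A) x', x'> = <A x, x> and |phi(A) x'| = |A x| for every A
    ([preserver_quadratic]). As x' runs over all lines, polarization makes phi
    complex linear, *-preserving and multiplicative. Finally, if
    phi(e (x) e) = e' (x) e', the formula U x = phi(x (x) e) e' defines the unitary
    that implements phi ([star_automorphism_spatial]). *)

(** * Inner products and adjoints *)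

Section HilbertSpace.
Context {R : realType} {H : hilbertType R}.
Implicit Types (x y z u v w e : H) (S T A B C D Q X Y : 'B(H)).
Implicit Types (a b c l : R[i]) (s t k eps : R) (phi psi : 'B(H) -> 'B(H)).

Lemma innerDl x y z : '<x + y, z> = '<x, z> + '<y, z>.
Proof. exact: linearDl. Qed.
Lemma innerDr x y z : '<x, y + z> = '<x, y> + '<x, z>.
Proof. exact: linearDr. Qed.
Lemma innerNl x y : '<- x, y> = - '<x, y>.
Proof. exact: linearNl. Qed.
Lemma innerNr x y : '<x, - y> = - '<x, y>.
Proof. exact: linearNr. Qed.
Lemma inner0l x : '<0, x> = 0.
Proof. exact: linear0l. Qed.
Lemma inner0r x : '<x, 0> = 0.
Proof. exact: linear0r. Qed.
Lemma innerZl a x y : '<a *: x, y> = a * '<x, y>.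
Proof. exact: linearZl_LR. Qed.
Lemma innerZr a x y : '<x, a *: y> = Num.conj a * '<x, y>.
Proof. exact: linearZr_LR. Qed.
Definition innerE :=
  (innerDl, innerDr, innerNl, innerNr, innerZl, innerZr, inner0l, inner0r).

Lemma inner_adjoint T x y : '<x, T y> = '<adjoint T x, y>.
Proof. by rewrite innerC adjointP -innerC. Qed.

Lemma inner_eq0 x : '<x, x> = 0 -> x = 0.
Proof. by move=> /eqP; rewrite dnorm_eq0 => /eqP. Qed.

Lemma inner_ext x y : (forall z, '<x, z> = '<y, z>) -> x = y.
Proof.
move=> xy; apply/eqP; rewrite -subr_eq0; apply/eqP/inner_eq0.
by rewrite innerDl innerNl xy subrr.
Qed.

Lemma bop_ext S T : (forall x y, '<S x, y> = '<T x, y>) -> S = T.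
Proof. by move=> ST; apply: bopP => x; apply: inner_ext. Qed.

(** Over the complex numbers the quadratic form determines the operator, by
    polarization at x + y and x + i y. *)
Lemma bop_quadratic_ext S T : (forall x, '<S x, x> = '<T x, x>) -> S = T.
Proof.
move=> ST; apply: bop_ext => x y.
have := ST (x + y); have := ST (x + 'i *: y).
rewrite !linearD !linearZ /= !innerE !ST conjCi => e1 e2.
have i2 : ('i : R[i]) * 'i = -1 by rewrite -expr2 sqrCi.
apply: (@mulIf _ 2); first by rewrite pnatr_eq0.
apply/eqP; rewrite -subr_eq0; apply/eqP.
move/eqP: e1; rewrite -subr_eq0 => /eqP e1.
move/eqP: e2; rewrite -subr_eq0 => /eqP e2.
transitivity (('i * 0 + 0 : R[i]) + (('i : R[i]) * 'i + 1) *
  ('<S x, y> - '<T x, y> - ('<S y, x> - '<T y, x>))); last by rewrite i2; ring.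
by rewrite -{1}e1 -e2; ring.
Qed.

Lemma adjointE T S : (forall x y, '<T x, y> = '<x, S y>) -> adjoint T = S.
Proof.
move=> TS; apply: bop_ext => x y.
by rewrite innerC -adjointP TS -innerC.
Qed.

Lemma adjointK T : adjoint (adjoint T) = T.
Proof. by apply: adjointE => x y; rewrite inner_adjoint. Qed.

Lemma adjoint1 : adjoint (1 : 'B(H)) = 1.
Proof. exact: adjointE. Qed.

Lemma adjointD S T : adjoint (S + T) = adjoint S + adjoint T.
Proof. by apply: adjointE => x y; rewrite !bopE !innerE !adjointP. Qed.

Lemma adjointN T : adjoint (- T) = - adjoint T.
Proof. by apply: adjointE => x y; rewrite !bopE !innerE !adjointP. Qed.

Lemma adjointZ a T : adjoint (a *: T) = Num.conj a *: adjoint T.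
Proof. by apply: adjointE => x y; rewrite !bopE !innerE !adjointP conjCK. Qed.

Lemma adjointM S T : adjoint (S * T) = adjoint T * adjoint S.
Proof. by apply: adjointE => x y; rewrite !bopE !adjointP. Qed.

Lemma bopZr T a x : T (a *: x) = a *: T x. Proof. exact: linearZ. Qed.
Lemma bopDr T x y : T (x + y) = T x + T y. Proof. exact: linearD. Qed.
Lemma bopNr T x : T (- x) = - T x. Proof. exact: linearN. Qed.
Lemma bop0r T : T 0 = 0. Proof. exact: linear0. Qed.
Definition bop_linE := (bopZr, bopDr, bopNr, bop0r).

Lemma bop_scalerAl a S T : a *: S * T = a *: (S * T).
Proof. exact: bopP. Qed.

Lemma bop_scalerAr a S T : S * (a *: T) = a *: (S * T).
Proof. by apply: bopP => x; rewrite !bopE linearZ. Qed.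

Lemma Re_conj a : complex.Re (Num.conj a) = complex.Re a.
Proof. by case: a. Qed.

Lemma conjCr (t : R) : Num.conj t%:C = t%:C.
Proof. exact: conjc_real. Qed.

Lemma rnorm_sqE x : rnorm x ^+ 2 = complex.Re '<x, x>.
Proof. by rewrite -rnorm_sq. Qed.

Lemma rnorm_sqD x y :
  rnorm (x + y) ^+ 2 = rnorm x ^+ 2 + rnorm y ^+ 2 + 2 * complex.Re '<x, y>.
Proof.
rewrite !rnorm_sqE !innerE !raddfD /= (innerC y x) Re_conj.
by ring.
Qed.

Lemma rnorm_sqN x : rnorm (- x) ^+ 2 = rnorm x ^+ 2.
Proof. by rewrite rnormN. Qed.

Lemma Re_realM (t : R) a : complex.Re (t%:C * a) = t * complex.Re a.
Proof. by case: a => a b /=; rewrite mul0r subr0. Qed.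

Lemma rnormZ_real (t : R) x : 0 <= t -> rnorm (t%:C *: x) = t * rnorm x.
Proof. by move=> t0; rewrite rnormZ ger0_norm ?ler0c. Qed.

Lemma Re_CauchySchwarz x y : complex.Re '<x, y> <= rnorm x * rnorm y.
Proof.
rewrite -lecR rmorphM /= !rnormE; apply: le_trans (inner_CauchySchwarz x y).
case: '<x, y> => p q; rewrite /= normc_def lecR /=.
apply: le_trans (ler_norm p) _.
by rewrite -sqrtr_sqr ler_sqrt ?addr_ge0 ?sqr_ge0 // lerDl sqr_ge0.
Qed.

Lemma rnorm_gt0 x : (0 < rnorm x) = (x != 0).
Proof. by rewrite lt_def rnorm_ge0 rnorm_eq0 andbT. Qed.

Lemma ler_sqr_nonneg (s t : R) : 0 <= s -> 0 <= t -> (s ^+ 2 <= t ^+ 2) = (s <= t).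
Proof. by move=> s0 t0; rewrite ler_sqr ?nnegrE. Qed.

End HilbertSpace.

(** * Rank-one operators and coercive operators *)

Section BoundedOperators.
Context {R : realType} {H : hilbertType R}.
Implicit Types (x y z u v w e : H) (S T A B C D Q X Y : 'B(H)).
Implicit Types (a b c l : R[i]) (s t k eps : R) (phi psi : 'B(H) -> 'B(H)).

Fact rank1_linear x y : linear (fun v => '<v, y> *: x).
Proof. by move=> a u v; rewrite !innerE scalerDl scalerA. Qed.

Lemma Re_norm_real a : (complex.Re `|a|)%:C = `|a|.
Proof. by rewrite RRe_real ?normr_real. Qed.

Lemma Re_norm_inner x y : complex.Re `|'<x, y>| <= rnorm x * rnorm y.
Proof.
by rewrite -lecR rmorphM /= !rnormE Re_norm_real inner_CauchySchwarz.
Qed.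

Fact rank1_bounded x y : bounded_map (fun v => '<v, y> *: x).
Proof.
exists (rnorm y * rnorm x); first by rewrite mulr_ge0 ?rnorm_ge0.
move=> v; rewrite rnormZ mulrAC ler_wpM2r ?rnorm_ge0 // mulrC.
exact: Re_norm_inner.
Qed.

Definition rank1 x y : 'B(H) := BOp (rank1_linear x y) (rank1_bounded x y).

Lemma rank1E x y v : rank1 x y v = '<v, y> *: x. Proof. by []. Qed.

Lemma adjoint_rank1 x y : adjoint (rank1 x y) = rank1 y x.
Proof.
by apply: adjointE => u v; rewrite !rank1E !innerE -innerC mulrC.
Qed.

Lemma mul_rank1 T x y : T * rank1 x y = rank1 (T x) y.
Proof. by apply: bopP => v; rewrite bopE !rank1E linearZ. Qed.

Lemma rank1_mul T x y : rank1 x y * T = rank1 x (adjoint T y).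
Proof. by apply: bopP => v; rewrite bopE !rank1E adjointP. Qed.

Lemma opnorm_le (e : R) T :
  0 <= e -> (forall x, rnorm (T x) <= e * rnorm x) -> opnorm T <= e.
Proof.
move=> e0 Te; apply: ge_sup; first by exists (rnorm (T 0)), 0 => //=; rewrite rnorm0.
move=> _ [x /= x1 <-]; apply: le_trans (Te x) _.
by rewrite -[leRHS]mulr1 ler_wpM2l.
Qed.

Lemma opnormP T x : rnorm (T x) <= opnorm T * rnorm x.
Proof.
have [->|x0] := eqVneq x 0; first by rewrite linear0 !rnorm0 mulr0.
have nx : 0 < rnorm x by rewrite rnorm_gt0.
rewrite -ler_pdivrMr //; apply: ub_le_sup.
  have [M M0 TM] := bop_bounded T; exists M => _ [y /= y1 <-].
  by apply: le_trans (TM y) _; rewrite -[leRHS]mulr1 ler_wpM2l.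
exists ((rnorm x)^-1%:C *: x) => /=.
  by rewrite rnormZ_real ?invr_ge0 ?rnorm_ge0 // mulVf ?lexx // gt_eqF.
by rewrite linearZ rnormZ_real ?invr_ge0 ?rnorm_ge0 // mulrC.
Qed.

(** Approximate solutions of T x = y form a Cauchy filter when T is bounded below,
    and completeness turns their limit into an exact solution. *)
Lemma bounded_below_solvable (c : R) T y : 0 < c ->
  (forall x, c * rnorm x <= rnorm (T x)) ->
  (forall e : R, 0 < e -> exists x, rnorm (T x - y) < e) ->
  exists x, T x = y.
Proof.
move=> c0 Tc Ty.
pose K (e : R) := [set x | rnorm (T x - y) < e].
(* The approximate solutions of precision e, for e tending to 0. *)
pose F := filter_from [set e : R | 0 < e] K.
have FF : ProperFilter F.
  apply: filter_from_proper; last by move=> e /= /Ty.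
  apply: filter_from_filter; first by exists 1 => /=.
  move=> e e' /= e0 e'0; exists (Num.min e e'); first by rewrite lt_min e0.
  by move=> x; rewrite /K /= lt_min => /andP[].
have : cauchy F.
  apply: cauchy_exP => r r0.
  have [s sE] : exists s : R, s%:C = r.
    by exists (complex.Re r); rewrite RRe_real ?gtr0_real.
  have s0 : 0 < s by rewrite -(ltcR 0) sE.
  have e0 : 0 < c * s / 2 by rewrite divr_gt0 ?mulr_gt0.
  have [x Kx] := Ty _ e0; exists x, (c * s / 2) => // z Kz.
  rewrite -ball_normE /= -sE -rnormE ltcR -(ltr_pM2l c0).
  apply: le_lt_trans (Tc _) _; rewrite linearB /=.
  have -> : T x - T z = (T x - y) - (T z - y) by rewrite opprB addrA subrK.
  apply: le_lt_trans (rnormB _ _) _; rewrite /K /= in Kz.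
  by move: Kx Kz; lra.
move=> /cauchy_cvg /cvg_ex [z Fz].
exists z; apply/eqP; rewrite -subr_eq0 -rnorm_eq0 eq_le rnorm_ge0 andbT.
have [M M0 TM] := bop_bounded T.
apply/ler_addgt0Pr => e e0; rewrite add0r.
have d0 : 0 < e / 2 / (M + 1) by rewrite !divr_gt0 // ltr_wpDl.
have : F (K (e / 2) `&` ball z (e / 2 / (M + 1))%:C).
  apply: filterI; first by exists (e / 2) => //=; rewrite divr_gt0.
  by apply: Fz; apply: nbhsx_ballx; rewrite (ltcR 0).
move=> /filter_ex [x [Kx]]; rewrite -ball_normE /= -rnormE ltcR => zx.
have -> : T z - y = T (z - x) + (T x - y) by rewrite linearB /= addrA subrK.
apply: le_trans (rnormD _ _) _.
have : rnorm (T (z - x)) <= e / 2.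
  apply: le_trans (TM _) _.
  apply: le_trans (_ : (M + 1) * (e / 2 / (M + 1)) <= _).
    by apply: ler_pM => //; rewrite ?rnorm_ge0 // ?ltW // ltrDl.
  by rewrite mulrC divfK // gt_eqF // ltr_wpDl.
by rewrite /K /= in Kx; move: Kx; lra.
Qed.

Lemma bounded_below_invertible (c : R) T : 0 < c ->
  (forall x, c * rnorm x <= rnorm (T x)) ->
  (forall y, exists x, T x = y) -> bop_invertible T.
Proof.
move=> c0 Tc Tsurj; have [f fE] := choice Tsurj.
have Tinj x y : T x = T y -> x = y.
  move=> xy; apply/eqP; rewrite -subr_eq0 -rnorm_eq0 eq_le rnorm_ge0 andbT.
  by rewrite -(ler_pM2l c0) mulr0; apply: le_trans (Tc _) _;
    rewrite linearB /= xy subrr rnorm0.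
have f_lin : linear f by move=> a u v; apply: Tinj; rewrite linearP /= !fE.
have f_bnd : bounded_map f.
  exists c^-1; first by rewrite invr_ge0 ltW.
  by move=> x; rewrite mulrC ler_pdivlMr // mulrC -{2}(fE x).
exists (BOp f_lin f_bnd); split; apply: bopP => x; rewrite !bopE /=.
  exact/Tinj/fE.
exact: fE.
Qed.

(** Lax-Milgram. For small t > 0 the operator 1 - t T is a strict contraction, so
    the iteration x |-> x - t (T x - y) makes the residual T x - y as small as
    desired, and the range of T, which is closed, is the whole space. *)
Lemma coercive_invertible (c : R) T : 0 < c ->
  (forall x, c * rnorm x ^+ 2 <= complex.Re '<T x, x>) -> bop_invertible T.
Proof.
move=> c0 Tc.
have Tbelow x : c * rnorm x <= rnorm (T x).
  have [->|x0] := eqVneq x 0; first by rewrite linear0 !rnorm0 mulr0.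
  have nx : 0 < rnorm x by rewrite rnorm_gt0.
  rewrite -(ler_pM2r nx) -mulrA -expr2.
  exact: le_trans (Tc x) (Re_CauchySchwarz _ _).
apply: (bounded_below_invertible c) => // y.
apply: (bounded_below_solvable c) => // e e0.
have [M' M'0 TM'] := bop_bounded T.
pose M := M' + c + 1.
have TM x : rnorm (T x) <= M * rnorm x.
  apply: le_trans (TM' x) _; rewrite ler_wpM2r ?rnorm_ge0 // /M.
  by lra.
have M0 : 0 < M by rewrite /M; lra.
have cM : c < M by rewrite /M; lra.
(* This t minimises 1 - 2 t c + t^2 M^2, which bounds the squared norm of
   1 - t T; the minimum is q. *)
pose t := c / M ^+ 2.
have t0 : 0 < t by rewrite divr_gt0 ?exprn_gt0.
pose q := 1 - c ^+ 2 / M ^+ 2.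
have qE : q = 1 + t ^+ 2 * M ^+ 2 - 2 * t * c.
  by rewrite /q /t; field; rewrite gt_eqF.
have q0 : 0 <= q.
  rewrite /q subr_ge0 ler_pdivrMr ?exprn_gt0 // mul1r.
  by rewrite ler_sqr_nonneg ltW // (lt_trans c0).
have q1 : q < 1 by rewrite /q ltrBlDr ltrDl divr_gt0 ?exprn_gt0.
have step x : rnorm (x - t%:C *: T x) ^+ 2 <= q * rnorm x ^+ 2.
  rewrite rnorm_sqD rnorm_sqN rnormZ_real ?(ltW t0) // innerNr raddfN /=.
  rewrite innerC innerZl Re_conj Re_realM exprMn qE.
  have : rnorm (T x) ^+ 2 <= (M * rnorm x) ^+ 2.
    by rewrite ler_sqr_nonneg ?mulr_ge0 ?rnorm_ge0 ?(ltW M0).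
  rewrite exprMn => /(ler_wpM2l (sqr_ge0 t)) n2.
  have := ler_wpM2l (ltW t0) (Tc x).
  by move: n2; nra.
pose it n := iter n (fun x => x - t%:C *: (T x - y)) 0.
have itP n : rnorm (T (it n) - y) ^+ 2 <= q ^+ n * rnorm y ^+ 2.
  elim: n => [|n IHn]; first by rewrite /it /= linear0 sub0r rnormN mul1r.
  have -> : T (it n.+1) - y = (T (it n) - y) - t%:C *: T (T (it n) - y).
    by rewrite /it /= linearB /= linearZ /= addrAC.
  apply: le_trans (step _) _; rewrite [q ^+ _]exprS -mulrA.
  exact: ler_wpM2l.
have [n qn] : exists n, q ^+ n * rnorm y ^+ 2 < e ^+ 2.
  have d0 : 0 < e ^+ 2 / (rnorm y ^+ 2 + 1).
    by rewrite divr_gt0 ?exprn_gt0 // ltr_wpDl ?sqr_ge0.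
  have /cvgrPdist_lt /(_ _ d0) [N _ /(_ N (leqnn N))] :
    GRing.exp q @ \oo --> (0 : R) by apply: cvg_expr; rewrite ger0_norm.
  rewrite /= sub0r normrN ger0_norm ?exprn_ge0 // => qN; exists N.
  move: qN; rewrite ltr_pdivlMr ?ltr_wpDl ?sqr_ge0 //; apply: le_lt_trans.
  by rewrite ler_wpM2l ?exprn_ge0 // lerDl.
exists (it n); rewrite -(ltr_pXn2r (n := 2)) ?nnegrE ?rnorm_ge0 ?(ltW e0) //.
exact: le_lt_trans (itP n) qn.
Qed.
End BoundedOperators.

(** * Pseudospectra and numerical ranges *)

Section Pseudospectrum.
Context {R : realType} {H : hilbertType R}.
Implicit Types (x y z u v w e : H) (S T A B C D Q X Y : 'B(H)).
Implicit Types (a b c l : R[i]) (s t k eps : R) (phi psi : 'B(H) -> 'B(H)).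

Lemma invertible_scale a T : a != 0 -> bop_invertible T -> bop_invertible (a *: T).
Proof.
move=> a0 [S [ST TS]]; exists (a^-1 *: S).
by rewrite !bop_scalerAl !bop_scalerAr !scalerA mulVf // mulfV // !scale1r.
Qed.

Lemma unit_conjM c : `|c| = 1 -> Num.conj c * c = 1.
Proof. by move=> c1; rewrite mulrC -normCK c1 expr1n. Qed.

Lemma unit_neq0 c : `|c| = 1 -> c != 0.
Proof. by move=> c1; rewrite -normr_eq0 c1 oner_eq0. Qed.

Lemma Re_inner_scale l v : complex.Re '<l *: v, v> = complex.Re l * rnorm v ^+ 2.
Proof. by rewrite innerZl -rnorm_sq mulrC Re_realM mulrC. Qed.

Definition self_adjoint T := adjoint T = T.

(** For self-adjoint X this is X <= s in the order of self-adjoint operators. *)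
Definition num_le X s := forall v, complex.Re '<X v, v> <= s * rnorm v ^+ 2.

(** If Re (conj c * l) > s + eps then, up to the factor c, the operator
    l - c X - A is coercive for every perturbation A of norm at most eps. *)
Lemma pseudospectrum_le eps c s X l : `|c| = 1 -> num_le X s ->
  pseudospectrum eps (c *: X) l -> complex.Re (Num.conj c * l) <= s + eps.
Proof.
move=> c1 Xs [A /= Ae]; rewrite /spectrum /= leNgt => lA; apply/negP => lt_l.
apply: lA.
set T := _ - _.
have -> : T = c *: (Num.conj c *: T).
  by rewrite scalerA mulrC unit_conjM // scale1r.
apply: invertible_scale; first exact: unit_neq0.
pose d := complex.Re (Num.conj c * l) - (s + eps).
apply: (coercive_invertible d); first by rewrite subr_gt0.
move=> v.
have -> : (Num.conj c *: T) v = (Num.conj c * l) *: v - X v - Num.conj c *: A v.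
  rewrite /T !bopE scalerBr scalerDr !scalerA unit_conjM // scale1r.
  by rewrite opprD addrA.
rewrite !innerDl !innerNl !raddfD /= !raddfN /= Re_inner_scale.
have := Xs v.
have : complex.Re '<Num.conj c *: A v, v> <= eps * rnorm v ^+ 2.
  apply: le_trans (Re_CauchySchwarz _ _) _.
  rewrite rnormZ norm_conjC c1 mul1r expr2 mulrA ler_wpM2r ?rnorm_ge0 //.
  by apply: le_trans (opnormP _ _) _; rewrite ler_wpM2r ?rnorm_ge0.
by rewrite /d; lra.
Qed.

Lemma num_leP X s : (forall v, rnorm v = 1 -> complex.Re '<X v, v> <= s) ->
  num_le X s.
Proof.
move=> Xs v; have [->|v0] := eqVneq v 0.
  by rewrite inner0r rnorm0 expr0n mulr0.
have nv : 0 < rnorm v by rewrite rnorm_gt0.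
have -> : v = (rnorm v)%:C *: ((rnorm v)^-1%:C *: v).
  by rewrite scalerA -rmorphM /= mulfV ?gt_eqF // scale1r.
set u := _^-1%:C *: v.
have u1 : rnorm u = 1.
  by rewrite /u rnormZ_real ?invr_ge0 ?rnorm_ge0 // mulVf // gt_eqF.
rewrite bopZr innerZl innerZr /= conjCr !Re_realM rnormZ_real ?rnorm_ge0 //.
rewrite u1 mulr1 mulrA -expr2 mulrC ler_wpM2r ?sqr_ge0 //.
exact: Xs.
Qed.

Lemma sa_inner_real X v : self_adjoint X -> '<X v, v> = (complex.Re '<X v, v>)%:C.
Proof.
move=> Xsa; have : '<X v, v> = Num.conj '<X v, v>.
  by rewrite -innerC adjointP Xsa.
by case: '<X v, v> => p q [/eqP]; rewrite -addr_eq0 -mulr2n mulrn_eq0 /= => /eqP->.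
Qed.

(** The Cauchy-Schwarz inequality for the form <B u, v>, obtained by evaluating
    the form at v - B v / K, where K bounds the norm of B. *)
Lemma positive_rnorm_sq_le B : self_adjoint B ->
  (forall v, 0 <= complex.Re '<B v, v>) ->
  exists2 K, 0 < K & forall v, rnorm (B v) ^+ 2 <= K * complex.Re '<B v, v>.
Proof.
move=> Bsa B0; have [K' K'0 BK'] := bop_bounded B.
pose K := K' + 1; have K0 : 0 < K by rewrite /K; lra.
exists K => // v.
have := B0 (v - (K^-1)%:C *: B v).
rewrite !bop_linE !innerE !raddfD /= !raddfN /= conjCr !Re_realM.
have -> : '<B (B v), v> = '<B v, B v> by rewrite adjointP Bsa.
rewrite -rnorm_sqE.
have : complex.Re '<B (B v), B v> <= K * rnorm (B v) ^+ 2.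
  apply: le_trans (Re_CauchySchwarz _ _) _; rewrite expr2 mulrA.
  rewrite ler_wpM2r ?rnorm_ge0 //; apply: le_trans (BK' _) _.
  by rewrite ler_wpM2r ?rnorm_ge0 // /K lerDl.
move: (complex.Re '<B v, v>) (complex.Re '<B (B v), B v>) (rnorm (B v) ^+ 2).
move=> p w n wn p0.
have Ki : 0 <= K^-1 by rewrite invr_ge0 ltW.
have wK : K^-1 * (K^-1 * w) <= K^-1 * n.
  by rewrite ler_wpM2l // ler_pdivrMl.
by rewrite -ler_pdivrMl //; lra.
Qed.

(** Vectors on which <B v, v> is small are approximate null vectors of B. *)
Lemma positive_not_invertible B : self_adjoint B ->
  (forall v, 0 <= complex.Re '<B v, v>) ->
  (forall e : R, 0 < e -> exists2 v, rnorm v = 1 & complex.Re '<B v, v> < e) ->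
  ~ bop_invertible B.
Proof.
move=> Bsa B0 Binf [S [SB _]].
have [K K0 BK] := positive_rnorm_sq_le B Bsa B0.
have [N' N'0 SN'] := bop_bounded S.
pose N := N' + 1; have N0 : 0 < N by rewrite /N; lra.
have NK : 0 < (N ^+ 2 * K)^-1 by rewrite invr_gt0 mulr_gt0 ?exprn_gt0.
have [v v1] := Binf _ NK.
have : 1 <= N * rnorm (B v).
  rewrite -[leLHS]v1 -{1}[v]bop1E -SB bopE; apply: le_trans (SN' _) _.
  by rewrite ler_wpM2r ?rnorm_ge0 // /N lerDl.
rewrite -ler_sqr_nonneg ?mulr_ge0 ?rnorm_ge0 ?(ltW N0) // expr1n exprMn => BN.
rewrite -[X in _ < X]mulr1 ltr_pdivlMl ?mulr_gt0 ?exprn_gt0 // ltNge => /negP; apply.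
by apply: le_trans BN _; rewrite -[leRHS]mulrA ler_wpM2l ?sqr_ge0.
Qed.

(** Let M be the supremum of the numerical range of X. Then M - X is positive and
    not invertible, so that c (M + eps) lies in the spectrum of c X + c eps. *)
Lemma num_le_of_pseudospectrum eps c s X : 0 < eps -> self_adjoint X -> `|c| = 1 ->
  (forall l, pseudospectrum eps (c *: X) l ->
     complex.Re (Num.conj c * l) <= s + eps) ->
  num_le X s.
Proof.
move=> eps0 Xsa c1 sX; apply: num_leP => v0 v01; rewrite leNgt; apply/negP => sv0.
pose W := [set complex.Re '<X v, v> | v in [set v | rnorm v = 1]].
have Wsup : has_sup W.
  split; first by exists (complex.Re '<X v0, v0>), v0.
  have [N N0 XN] := bop_bounded X; exists N => _ [v /= v1 <-].
  apply: le_trans (Re_CauchySchwarz _ _) _; rewrite v1 mulr1.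
  by apply: le_trans (XN _) _; rewrite v1 mulr1.
pose M := sup W.
have XM : num_le X M.
  by apply: num_leP => v v1; apply: ub_le_sup; [case: Wsup | exists v].
have sM : s < M.
  by apply: lt_le_trans sv0 _; have := XM v0; rewrite v01 expr1n mulr1.
pose B : 'B(H) := M%:C *: (1 : 'B(H)) - X.
have BE v : complex.Re '<B v, v> = M * rnorm v ^+ 2 - complex.Re '<X v, v>.
  by rewrite /B !bopE innerDl innerNl raddfB /= Re_inner_scale.
have Binv : ~ bop_invertible B.
  apply: positive_not_invertible => [|v|e e0].
  - by rewrite /self_adjoint /B adjointD adjointN adjointZ adjoint1 conjCr Xsa.
  - by rewrite BE subr_ge0.
  have [_ [v /= v1 <-] lt_v] := sup_adherent e0 Wsup.
  by exists v => //; rewrite BE v1 expr1n mulr1 ltrBlDr -ltrBlDl.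
have : pseudospectrum eps (c *: X) (c * (M + eps)%:C).
  (* The perturbation is the scalar c eps. *)
  exists ((c * eps%:C) *: (1 : 'B(H))) => /=.
    apply: opnorm_le => [|x]; first exact: ltW.
    rewrite bopE rnormZ normrM c1 mul1r ger0_norm ?bop1E ?lexx //.
    by rewrite ler0c ltW.
  rewrite /spectrum /=.
  have -> : (c * (M + eps)%:C) *: (1 : 'B(H)) -
      (c *: X + (c * eps%:C) *: (1 : 'B(H))) = c *: B.
    rewrite /B scalerBr scalerA rmorphD mulrDr scalerDl opprD.
    by rewrite addrACA subrr addr0.
  move=> cB; apply: Binv.
  have -> : B = c^-1 *: (c *: B).
    by rewrite scalerA mulVf ?scale1r // unit_neq0.
  by apply: invertible_scale => //; rewrite invr_neq0 // unit_neq0.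
move=> /sX; rewrite mulrA unit_conjM // mul1r /=.
by move: sM; lra.
Qed.

Lemma eq_pseudospectrum_num_le eps c X Y s : 0 < eps -> self_adjoint Y ->
  `|c| = 1 -> pseudospectrum eps (c *: X) = pseudospectrum eps (c *: Y) ->
  num_le X s -> num_le Y s.
Proof.
move=> eps0 Ysa c1 XY Xs; apply: (num_le_of_pseudospectrum eps c) => //.
by rewrite -XY => l; apply: pseudospectrum_le.
Qed.

(** Otherwise a perturbation of rank one and norm at most eps, mapping v to
    l v - X v, turns v into an eigenvector for l. *)
Lemma pseudospectrum_lower_bound eps X l v : ~ pseudospectrum eps X l ->
  eps * rnorm v <= rnorm (l *: v - X v).
Proof.
move=> lX; have [->|v0] := eqVneq v 0; first by rewrite rnorm0 mulr0 rnorm_ge0.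
rewrite leNgt; apply/negP => lt_e; apply: lX.
have nv : 0 < rnorm v by rewrite rnorm_gt0.
have e0 : 0 <= eps.
  by rewrite -(pmulr_lge0 _ nv) (le_trans _ (ltW lt_e)) ?rnorm_ge0.
pose u := ((rnorm v ^+ 2)^-1)%:C *: v.
pose w := l *: v - X v.
have uv : '<v, u> = 1.
  rewrite innerZr conjCr -rnorm_sq -rmorphM /= mulVf //.
  by rewrite expf_neq0 // gt_eqF.
exists (rank1 w u) => /=.
  apply: opnorm_le => // y; rewrite rank1E rnormZ.
  apply: le_trans (ler_wpM2r (rnorm_ge0 _) (Re_norm_inner _ _)) _.
  rewrite rnormZ_real ?invr_ge0 ?sqr_ge0 // -!mulrA mulrC ler_wpM2r ?rnorm_ge0 //.
  rewrite ler_pdivrMl ?exprn_gt0 // expr2 -mulrA ler_pM2l // mulrC.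
  exact: ltW.
move=> [S [ST _]]; move: v0; rewrite -[v]bop1E -ST !bopE rank1E uv scale1r.
by rewrite /w [X v + _]addrC subrK subrr bop0r eqxx.
Qed.

(** Were z = <X v, v> nonzero, apply the lower bound of the resolvent at
    mu z / |z| with mu slightly above eps. At mu = eps it says
    2 eps t |z| <= t^2 |X v|^2, which fails for small t. *)
Lemma eq0_of_pseudospectrum eps X : 0 < eps ->
  (forall t, 0 < t -> pseudospectrum eps (t%:C *: X) = pseudospectrum eps (0 : 'B(H))) ->
  X = 0.
Proof.
move=> eps0 X0; apply: bop_quadratic_ext => v; rewrite bopE inner0l.
apply/eqP; apply: contraT => z0.
set z := '<X v, v> in z0.
pose r := complex.Re `|z|.
have rE : r%:C = `|z| by exact: Re_norm_real.
have r0 : 0 < r by rewrite -(ltcR 0) rE normr_gt0.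
pose c := z / r%:C.
have rC0 : r%:C != 0 by rewrite rE normr_eq0.
have c1 : `|c| = 1 by rewrite normrM normfV rE normr_id mulfV // normr_eq0.
have cz : c * Num.conj z = r%:C.
  by rewrite /c mulrAC -normCK -rE expr2 mulfK.
have bound t mu : 0 < t -> eps < mu ->
    eps ^+ 2 * rnorm v ^+ 2 + 2 * mu * t * r <=
    mu ^+ 2 * rnorm v ^+ 2 + t ^+ 2 * rnorm (X v) ^+ 2.
  move=> t0 mu0.
  have /(pseudospectrum_lower_bound _ _ _ v) :
      ~ pseudospectrum eps (t%:C *: X) (mu%:C * c).
    rewrite X0 // -(scaler0 _ c) => /pseudospectrum_le.
    move=> /(_ 0 c1); rewrite mulrCA unit_conjM // mulr1 add0r /= leNgt mu0.
    suff : num_le (0 : 'B(H)) 0 by move=> n0 /(_ n0).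
    by move=> u; rewrite bopE inner0l mul0r.
  rewrite -ler_sqr_nonneg ?mulr_ge0 ?rnorm_ge0 ?(ltW eps0) // exprMn.
  rewrite rnorm_sqD rnorm_sqN bopE rnormZ_real ?(ltW t0) //.
  have -> : '<(mu%:C * c) *: v, - (t%:C *: X v)> = - ((mu * t * r)%:C).
    rewrite innerNr innerZl innerZr conjCr innerC -/z.
    by rewrite !rmorphM /= -cz; ring.
  have mu0' : 0 < mu by apply: lt_trans mu0.
  rewrite rnormZ normrM c1 mulr1 ger0_norm ?ler0c ?(ltW mu0') // raddfN /=.
  by rewrite !exprMn; lra.
pose a := rnorm v ^+ 2; pose b := rnorm (X v) ^+ 2.
have a0 : 0 <= a by exact: sqr_ge0.
have b0 : 0 <= b by exact: sqr_ge0.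
have a1 : 0 < a + 1 by rewrite ltr_wpDl.
(* With this t the term t^2 b is at most eps t r, half of the term of first order;
   then d, the excess of mu over eps, is small enough to be absorbed too. *)
pose t := eps * r / (b + 1).
have t0 : 0 < t by rewrite divr_gt0 ?mulr_gt0 // ltr_wpDl.
have tb : t * b <= eps * r.
  rewrite /t mulrAC ler_pdivrMr ?ltr_wpDl // ler_wpM2l ?mulr_ge0 ?(ltW eps0) ?(ltW r0) //.
  by rewrite lerDl.
pose d := Num.min eps (t * r / (4 * (a + 1))).
have a4 : 0 < 4 * (a + 1) by lra.
have d0 : 0 < d by rewrite lt_min eps0; apply: divr_gt0 => //; exact: mulr_gt0.
have de : d <= eps by rewrite ge_min lexx.
have da : d * (4 * (a + 1)) <= t * r.
  by rewrite -ler_pdivlMr // ge_min lexx orbT.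
have := bound t (eps + d) t0; rewrite ltrDl => /(_ d0).
rewrite -/a -/b.
have tt : t * (t * b) <= t * (eps * r) by rewrite ler_wpM2l // ltW.
have dd : d * d <= eps * d by rewrite ler_wpM2r // ltW.
have dda : d * d * a <= eps * d * a by rewrite ler_wpM2r.
have dea : eps * (d * (4 * (a + 1))) <= eps * (t * r).
  by rewrite ler_wpM2l // ltW.
have dtr : 0 < d * t * r by exact: mulr_gt0 (mulr_gt0 d0 t0) r0.
have ed : 0 < eps * d by rewrite mulr_gt0.
have eda : 0 <= eps * d * a by rewrite mulr_ge0 // ltW.
clear -tt dda dea dtr ed eda; clearbody a b t d; rewrite !expr2 => bnd.
by exfalso; lra.
Qed.
End Pseudospectrum.

(** * The triple product *)

Section Triple.
Context {R : realType} {H : hilbertType R}.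
Implicit Types (x y z u v w e : H) (S T A B C D Q X Y : 'B(H)).
Implicit Types (a b c l : R[i]) (s t k eps : R) (phi psi : 'B(H) -> 'B(H)).

Definition triple A B C := skew_lie (jordan_star A B) C.

Definition scalar_op a : 'B(H) := a *: (1 : 'B(H)).

Lemma scalar_opE a v : scalar_op a v = a *: v. Proof. by []. Qed.

Lemma adjoint0 : adjoint (0 : 'B(H)) = 0.
Proof. by apply: adjointE => x y; rewrite !bopE !innerE. Qed.

Lemma adjoint_scalar_op a : adjoint (scalar_op a) = scalar_op (Num.conj a).
Proof. by rewrite /scalar_op adjointZ adjoint1. Qed.

Lemma tripleE A B C :
  triple A B C = A * B * C + B * adjoint A * C
                 - (C * adjoint B * adjoint A + C * A * adjoint B).
Proof.
rewrite /triple /skew_lie /jordan_star adjointD !adjointM adjointK.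
by rewrite mulrDl mulrDr !mulrA.
Qed.

Local Ltac bop_ring :=
  apply: bop_ext => ? ?;
  rewrite ?tripleE ?adjoint_scalar_op !(scalar_opE, bopE, bop_linE, innerE);
  ring.

Lemma triple_scalarl a B C :
  triple (scalar_op a) B C = (a + Num.conj a) *: (B * C - C * adjoint B).
Proof. bop_ring. Qed.

Lemma triple_scalarm A b C :
  triple A (scalar_op b) C =
  b *: ((A + adjoint A) * C) - Num.conj b *: (C * (A + adjoint A)).
Proof. bop_ring. Qed.

Lemma triple_scalarr A B c :
  triple A B (scalar_op c) =
  c *: (A * (B - adjoint B) + (B - adjoint B) * adjoint A).
Proof. bop_ring. Qed.

Lemma triple_scaler A B C t : triple (t%:C *: A) B C = t%:C *: triple A B C.
Proof.
apply: bop_ext => x y; rewrite !tripleE adjointZ conjCr !(bopE, bop_linE, innerE).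
by ring.
Qed.

(** Replacing A by i A separates the linear and the conjugate-linear part in A, so
    that A B C = C A (adj B) for every A. For A of rank one with range spanned by
    x, this makes x an eigenvector of C, hence C is scalar. *)
Lemma triple_left_annihilator B C : B != 0 -> C != 0 ->
  (forall A, triple A B C = 0) ->
  self_adjoint B /\ exists c, C = scalar_op c.
Proof.
move=> B0 C0 BC0.
have ABC A : A * B * C = C * A * adjoint B.
  have e1 := BC0 A; have e2 := BC0 ('i *: A).
  apply: bop_ext => x y.
  have e0 (T : 'B(H)) : T = 0 -> '<T x, y> = 0 by move=> ->; rewrite bopE inner0l.
  move: (e0 _ e1) (e0 _ e2).
  rewrite !tripleE adjointZ conjCi !(bopE, bop_linE, innerE).
  move=> f1 f2; apply: (@mulfI _ (2 * 'i)); first by rewrite mulf_neq0 ?pnatr_eq0 ?neq0Ci.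
  apply/eqP; rewrite -subr_eq0; apply/eqP.
  transitivity (0 + 'i * (0 : R[i])); last by rewrite mulr0 addr0.
  by rewrite -{1}f2 -f1; ring.
(* Compare both sides on v, for A the operator x (x) (adj B v). *)
have [v Bv] : exists v, adjoint B v != 0.
  apply: contrapT => /forallNP allB; move/eqP: B0; apply.
  rewrite -[B]adjointK -[RHS]adjoint0; congr adjoint.
  by apply: bopP => v; have /negP := allB v; rewrite negbK => /eqP.
have CE x : C x = ('<B (C v), adjoint B v> / '<adjoint B v, adjoint B v>) *: x.
  have /(congr1 (fun T : 'B(H) => T v)) := ABC (rank1 x (adjoint B v)).
  rewrite !bopE !rank1E bopZr mulrC -scalerA => ->.
  by rewrite scalerA mulVf ?scale1r // dnorm_eq0.
have {CE}CE : C = scalar_op ('<B (C v), adjoint B v> / '<adjoint B v, adjoint B v>).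
  by apply: bopP => x; rewrite CE.
move: C0 (ABC 1); rewrite CE; move: (_ / _) => c c0 cB.
split; last by exists c.
have {}c0 : c != 0.
  by apply: contra_neq c0 => ->; apply: bopP => x; rewrite scalar_opE scale0r.
apply: bopP => x; apply: (scalerI c0).
have /(congr1 (fun T : 'B(H) => T x)) := cB.
by rewrite mul1r mulr1 !bopE bopZr.
Qed.
End Triple.

(** * Preservers fix 1 and i *)

Section Preserver.
Context {R : realType} {H : hilbertType R}.
Implicit Types (x y z u v w e : H) (S T A B C D Q X Y : 'B(H)).
Implicit Types (a b c l : R[i]) (s t k eps : R) (phi psi : 'B(H) -> 'B(H)).

Lemma self_adjointZ t X : self_adjoint X -> self_adjoint (t%:C *: X).
Proof. by rewrite /self_adjoint adjointZ conjCr => ->. Qed.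

Lemma num_leZ k s X : 0 < k -> num_le (k%:C *: X) (k * s) <-> num_le X s.
Proof.
move=> k0; split=> Xs v; have := Xs v;
  by rewrite bopE innerZl Re_realM -mulrA ler_pM2l.
Qed.

Lemma num_le0 : num_le (0 : 'B(H)) 0.
Proof. by move=> v; rewrite bopE inner0l mul0r. Qed.

Lemma num_le_anti X : self_adjoint X -> num_le X 0 -> num_le (- X) 0 -> X = 0.
Proof.
move=> Xsa X0 X0'; apply: bop_quadratic_ext => v; rewrite bopE inner0l.
rewrite sa_inner_real //.
have := X0 v; have := X0' v.
rewrite bopE innerNl raddfN /= !mul0r oppr_le0 => ge0 le0.
by congr (_%:C); apply/eqP; rewrite eq_le le0 ge0.
Qed.

Definition preserver eps phi := bijective phi /\ forall A B C,
  pseudospectrum eps (triple A B C) =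
  pseudospectrum eps (triple (phi A) (phi B) (phi C)).

Lemma preserver_inverse eps phi psi : cancel phi psi -> cancel psi phi ->
  preserver eps phi -> preserver eps psi.
Proof.
move=> phiK psiK [_ phiP]; split; first by exists phi.
by move=> A B C; rewrite [RHS]phiP !psiK.
Qed.

Lemma preserver_inj eps phi : preserver eps phi -> injective phi.
Proof. by move=> [/bij_inj]. Qed.

Lemma preserver_surj eps phi : preserver eps phi -> forall B, exists A, phi A = B.
Proof. by move=> [[psi _ psiK] _] B; exists (psi B). Qed.

Section Fixed.
Context {eps : R} (eps0 : 0 < eps).

(** How numerical ranges are read off from triple products: the products that
    matter are self-adjoint up to a factor c k with |c| = 1 and k > 0. *)
Lemma preserver_num phi A B C c k X Y : preserver eps phi -> `|c| = 1 -> 0 < k ->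
  triple A B C = (c * k%:C) *: X ->
  triple (phi A) (phi B) (phi C) = (c * k%:C) *: Y ->
  self_adjoint X -> self_adjoint Y -> forall s, num_le X s <-> num_le Y s.
Proof.
move=> [_ phiP] c1 k0 XE YE Xsa Ysa s.
have := phiP A B C; rewrite XE YE -!scalerA => XY.
by split=> /(num_leZ k s _ k0) les; apply/(num_leZ k s _ k0);
  apply: (eq_pseudospectrum_num_le _ c _ _ _ eps0) les => //;
  exact: self_adjointZ.
Qed.

Lemma preserver_zero phi A B C c Y : preserver eps phi -> `|c| = 1 ->
  triple A B C = 0 -> triple (phi A) (phi B) (phi C) = c *: Y ->
  self_adjoint Y -> Y = 0.
Proof.
move=> [_ phiP] c1 ABC YE Ysa; have := phiP A B C; rewrite ABC YE => sY.
apply: num_le_anti => //.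
  apply: (eq_pseudospectrum_num_le _ c _ _ _ eps0) num_le0 => //.
  by rewrite scaler0.
apply: (eq_pseudospectrum_num_le _ (- c) _ _ _ eps0) num_le0.
- by rewrite /self_adjoint adjointN Ysa.
- by rewrite normrN.
- by rewrite scaler0 sY scalerN scaleNr opprK.
Qed.

(** Here the real homogeneity in the first slot supplies the scaling that
    [eq0_of_pseudospectrum] asks for. *)
Lemma preserver_left_annihilator phi B C : preserver eps phi ->
  (forall A, triple A B C = 0) -> forall A, triple A (phi B) (phi C) = 0.
Proof.
move=> phiP BC A; apply: (eq0_of_pseudospectrum _ _ eps0) => t t0.
rewrite -triple_scaler; have [D <-] := preserver_surj _ _ phiP (t%:C *: A).
by rewrite -(proj2 phiP) BC.
Qed.

Lemma triple_1i C : triple 1 (scalar_op 'i) C = ('i * 4%:C) *: C.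
Proof.
rewrite triple_scalarm adjoint1 conjCi.
by apply: bop_ext => x y; rewrite !(bopE, bop_linE, innerE); ring.
Qed.

Lemma preserver0 phi : preserver eps phi -> phi 0 = 0.
Proof.
move=> phiP.
have A0 B A : triple A B (phi 0) = 0.
  have [D <-] := preserver_surj _ _ phiP B.
  apply: preserver_left_annihilator => // {}A.
  by rewrite /triple /skew_lie mulr0 mul0r subrr.
have := A0 (scalar_op 'i) 1; rewrite triple_1i => /eqP.
rewrite scaler_eq0 => /orP[|/eqP//].
by rewrite mulf_eq0 (negPf (neq0Ci _)) /= (inj_eq (@complexI _)) pnatr_eq0.
Qed.

Context (H_neq0 : (1 : 'B(H)) != 0).

Lemma scalar_op_inj : injective (@scalar_op R H).
Proof.
move=> a b /eqP; rewrite -subr_eq0 /scalar_op -scalerBl scaler_eq0 (negPf H_neq0) orbF.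
by rewrite subr_eq0 => /eqP.
Qed.

Lemma num_le_scalar t s : num_le (scalar_op t%:C : 'B(H)) s <-> t <= s.
Proof.
have [v v0] : exists v : H, v != 0.
  apply: contrapT => /forallNP v0; move/eqP: H_neq0; apply; apply: bopP => v.
  by have /negP := v0 v; rewrite negbK => /eqP.
split=> [/(_ v)|ts u]; rewrite scalar_opE Re_inner_scale /=.
  by rewrite ler_pM2r // exprn_gt0 // rnorm_gt0.
by rewrite ler_wpM2r ?sqr_ge0.
Qed.

Lemma scalar_op1 : scalar_op 1 = 1 :> 'B(H).
Proof. exact: scale1r. Qed.

Lemma self_adjoint_scalar t : self_adjoint (scalar_op t%:C : 'B(H)).
Proof. by rewrite /self_adjoint adjoint_scalar_op conjCr. Qed.

Lemma preserver1_neq0 phi : preserver eps phi -> phi 1 != 0.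
Proof.
move=> phiP; apply: contra_neq H_neq0 => p1; apply: (preserver_inj _ _ phiP).
by rewrite p1 (preserver0 _ phiP).
Qed.

Lemma triple_sa_scalar A B c : self_adjoint B -> triple A B (scalar_op c) = 0.
Proof. by move=> Bsa; rewrite triple_scalarr Bsa subrr mulr0 mul0r addr0 scaler0. Qed.

(** F(., B, 1) = 0 for B self-adjoint, hence F(., phi(B), phi(1)) = 0 with phi(1)
    nonzero, and [triple_left_annihilator] applies. *)
Lemma preserver_sa phi B : preserver eps phi -> self_adjoint B ->
  self_adjoint (phi B).
Proof.
move=> phiP Bsa; have [->|B0] := eqVneq (phi B) 0; first exact: adjoint0.
have BC A : triple A (phi B) (phi 1) = 0.
  apply: preserver_left_annihilator => // {}A.
  by rewrite -scalar_op1 triple_sa_scalar.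
by have [] := triple_left_annihilator _ _ B0 (preserver1_neq0 _ phiP) BC.
Qed.

Lemma preserver_scalar phi c : preserver eps phi ->
  exists d, phi (scalar_op c) = scalar_op d.
Proof.
move=> phiP; have [->|c0] := eqVneq (phi (scalar_op c)) 0.
  by exists 0; rewrite /scalar_op scale0r.
have BC A : triple A (phi 1) (phi (scalar_op c)) = 0.
  apply: preserver_left_annihilator => // {}A.
  by apply: triple_sa_scalar; exact: adjoint1.
by have [] := triple_left_annihilator _ _ (preserver1_neq0 _ phiP) c0 BC.
Qed.

Lemma triple_scalars a b c :
  triple (scalar_op a) (scalar_op b) (scalar_op c) =
  scalar_op ((a + Num.conj a) * (b - Num.conj b) * c) :> 'B(H).
Proof.
rewrite triple_scalarl adjoint_scalar_op.
by apply: bop_ext => x y; rewrite !(scalar_opE, bopE, bop_linE, innerE); ring.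
Qed.

(** Say phi(1) = r and phi(i) = i a, with r and a real: phi(1) is self-adjoint, and
    phi(i) is imaginary because F(i, B, C) = 0 for all B and C. The products
    F(1, i, i) = -4 and F(1, i, 1) = 4 i give a^2 r = 1 and a r^2 = 1, hence
    a = r = 1. *)
Lemma preserver_1_i phi : preserver eps phi ->
  phi 1 = 1 /\ phi (scalar_op 'i) = scalar_op 'i.
Proof.
move=> phiP.
have [r' r'E] := preserver_scalar _ 1 phiP.
have [w wE] := preserver_scalar _ 'i phiP.
have [r rE] : exists r : R, phi 1 = scalar_op r%:C.
  have : self_adjoint (phi 1) by apply: preserver_sa => //; exact: adjoint1.
  rewrite -scalar_op1 r'E /self_adjoint adjoint_scalar_op => /scalar_op_inj rr.
  by exists (complex.Re r'); rewrite RRe_real // CrealE rr.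
have [a aE] : exists a : R, w = 'i * a%:C.
  have : w + Num.conj w = 0.
    have : scalar_op ((w + Num.conj w) * ('i - Num.conj 'i)) = 0 :> 'B(H).
      apply: (eq0_of_pseudospectrum _ _ eps0) => t t0.
      have [D DE] := preserver_surj _ _ phiP (scalar_op t%:C).
      have [D' D'E] := preserver_surj _ _ phiP (scalar_op 'i).
      have := proj2 phiP (scalar_op 'i) D' D.
      rewrite triple_scalarl conjCi subrr scale0r wE DE D'E triple_scalars => ->.
      by congr pseudospectrum; rewrite /scalar_op scalerA mulrC conjCi.
    rewrite -[0](scale0r (1 : 'B(H))) => /scalar_op_inj /eqP.
    rewrite conjCi opprK -mulr2n mulf_eq0 mulrn_eq0 (negPf (neq0Ci _)) !orbF.
    by move=> /eqP.
  case: w {wE} => p q; rewrite /Num.conj /= => -[p0 _].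
  exists q; rewrite -complexiE; apply/eqP; rewrite eq_complex /=.
  by rewrite !(mul0r, mul1r, mulr0, subrr, add0r, addr0) eqxx andbT; apply/eqP; lra.
rewrite {w}aE in wE.
have ii : ('i : R[i]) * 'i = -1 by rewrite -expr2 sqrCi.
have conj_ia : Num.conj ('i * a%:C) = - ('i * a%:C).
  by rewrite rmorphM /= conjCr conjCi mulNr.
have num1 t : (forall s, num_le (scalar_op 1%:C : 'B(H)) s <->
    num_le (scalar_op t%:C : 'B(H)) s) -> t = 1.
  move=> eqt; apply/eqP; rewrite eq_le; apply/andP; split.
    by apply/num_le_scalar/eqt/num_le_scalar.
  by apply/num_le_scalar/eqt/num_le_scalar.
have e1 : a * a * r = 1.
  apply: num1; apply: (preserver_num _ 1 (scalar_op 'i) (scalar_op 'i) (- 1) 4 _ _ phiP);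
    rewrite ?normrN1 //; try exact: self_adjoint_scalar.
    rewrite triple_1i /scalar_op !scalerA; congr (_ *: _).
    by rewrite mulrAC ii mulr1.
  rewrite rE wE triple_scalars conjCr conj_ia /scalar_op !scalerA; congr (_ *: _).
  transitivity (('i * 'i) * (4 * (a * a * r)%:C)); last by rewrite ii; ring.
  by rewrite !rmorphM /=; ring.
have e2 : a * r * r = 1.
  apply: num1; apply: (preserver_num _ 1 (scalar_op 'i) 1 'i 4 _ _ phiP);
    rewrite ?normCi //; try exact: self_adjoint_scalar.
    by rewrite triple_1i /scalar_op scale1r.
  rewrite rE wE triple_scalars conjCr conj_ia /scalar_op !scalerA; congr (_ *: _).
  by rewrite !rmorphM /=; ring.
have ar : a = r.
  have : a * (a * r * r) = (a * a * r) * r by ring.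
  by rewrite e1 e2 mulr1 mul1r.
have r1 : r = 1.
  apply/eqP; rewrite -subr_eq0; rewrite ar in e1.
  have : (r - 1) * (r * r + r + 1) = 0.
    by transitivity (r * r * r - 1); [ring | rewrite e1 subrr].
  move/eqP; rewrite mulf_eq0 => /orP[//|].
  by rewrite gt_eqF //; nra.
by rewrite rE wE ar r1 mulr1 scalar_op1.
Qed.
End Fixed.
End Preserver.

(** * Preservers and rank-one projections *)

Section RankOne.
Context {R : realType} {H : hilbertType R}.
Implicit Types (x y z u v w e : H) (S T A B C D Q X Y : 'B(H)).
Implicit Types (a b c l : R[i]) (s t k eps : R) (phi psi : 'B(H) -> 'B(H)).
Context {eps : R} (eps0 : 0 < eps).
Context (H_neq0 : (1 : 'B(H)) != 0).

Lemma triple_ii A : triple A (scalar_op 'i) (scalar_op 'i) =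
  (- 1 * 2%:C) *: (A + adjoint A).
Proof.
rewrite triple_scalarm conjCi.
apply: bop_ext => x y; rewrite !(bopE, scalar_opE, bop_linE, innerE).
have ii : ('i : R[i]) * 'i = -1 by rewrite -expr2 sqrCi.
transitivity (('i * 'i) * 2%:C * ('<A x, y> + '<adjoint A x, y>)); first by ring.
by rewrite ii.
Qed.

Lemma self_adjoint_re A : self_adjoint (A + adjoint A).
Proof. by rewrite /self_adjoint adjointD adjointK addrC. Qed.

(** F(A, i, i) = -4 A for self-adjoint A. *)
Lemma preserver_num_le phi A s : preserver eps phi -> self_adjoint A ->
  num_le A s <-> num_le (phi A) s.
Proof.
move=> phiP Asa; have Asa' := preserver_sa eps0 H_neq0 _ _ phiP Asa.
have [_ phi_i] := preserver_1_i eps0 H_neq0 _ phiP.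
apply: (preserver_num eps0 _ A (scalar_op 'i) (scalar_op 'i) (- 1) 4 _ _ phiP);
  rewrite ?normrN1 ?phi_i ?triple_ii ?Asa ?Asa' //.
  by apply: bop_ext => x y; rewrite !(bopE, innerE); ring.
by apply: bop_ext => x y; rewrite !(bopE, innerE); ring.
Qed.

Lemma preserver_skew phi A : preserver eps phi -> adjoint A = - A ->
  adjoint (phi A) = - phi A.
Proof.
move=> phiP Ask; have [_ phi_i] := preserver_1_i eps0 H_neq0 _ phiP.
have : 2%:C *: (phi A + adjoint (phi A)) = 0.
  apply: (preserver_zero eps0 _ A (scalar_op 'i) (scalar_op 'i) (- 1) _ phiP).
  - by rewrite normrN1.
  - by rewrite triple_ii Ask subrr scaler0.
  - by rewrite phi_i triple_ii scalerA.
  exact/self_adjointZ/self_adjoint_re.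
move/eqP; rewrite scaler_eq0 (inj_eq (@complexI _)) pnatr_eq0 /= addrC addr_eq0.
by move/eqP.
Qed.

Lemma triple_commutator A X c : self_adjoint A -> self_adjoint X ->
  triple 1 A (c *: X) = (- 'i * c) *: (2%:C *: ('i *: (A * X - X * A))).
Proof.
move=> Asa Xsa; rewrite tripleE adjoint1 Asa.
have ii : ('i : R[i]) * 'i = -1 by rewrite -expr2 sqrCi.
apply: bop_ext => x y; rewrite !(bopE, bop_linE, innerE).
transitivity (- ('i * 'i) * c * 2%:C * ('<A (X x), y> - '<X (A x), y>)); last by ring.
by rewrite ii; ring.
Qed.

Lemma triple_anticommutator A X c : self_adjoint A -> self_adjoint X ->
  triple A (scalar_op 'i) (c *: X) = ('i * c) *: (2%:C *: (A * X + X * A)).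
Proof.
move=> Asa Xsa; rewrite triple_scalarm conjCi Asa.
by apply: bop_ext => x y; rewrite !(bopE, bop_linE, innerE); ring.
Qed.

Lemma sa_mul0C A X : self_adjoint A -> self_adjoint X -> A * X = 0 -> X * A = 0.
Proof. by move=> Asa Xsa /(congr1 adjoint); rewrite adjointM adjoint0 Asa Xsa. Qed.

(** Both the commutator, from F(1, A, c X), and the anticommutator, from
    F(A, i, c X), of the images vanish. The values c = 1 and c = i are used. *)
Lemma preserver_mul0 phi A X Y c : preserver eps phi -> self_adjoint A ->
  self_adjoint X -> self_adjoint Y -> `|c| = 1 -> phi (c *: X) = c *: Y ->
  A * X = 0 -> phi A * Y = 0.
Proof.
move=> phiP Asa Xsa Ysa c1 phiX AX.
have XA := sa_mul0C _ _ Asa Xsa AX.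
have Asa' := preserver_sa eps0 H_neq0 _ _ phiP Asa.
have [phi_1 phi_i] := preserver_1_i eps0 H_neq0 _ phiP.
have two0 : (2%:C : R[i]) != 0 by rewrite (inj_eq (@complexI _)) pnatr_eq0.
have comm : 2%:C *: ('i *: (phi A * Y - Y * phi A)) = 0.
  apply: (preserver_zero eps0 _ 1 A (c *: X) (- 'i * c) _ phiP).
  - by rewrite normrM normrN normCi c1 mulr1.
  - by rewrite triple_commutator // AX XA subrr !scaler0.
  - by rewrite phi_1 phiX triple_commutator.
  apply: self_adjointZ.
  rewrite /self_adjoint adjointZ adjointD adjointN !adjointM Asa' Ysa conjCi.
  by rewrite scaleNr -scalerN opprB.
have anti : 2%:C *: (phi A * Y + Y * phi A) = 0.
  apply: (preserver_zero eps0 _ A (scalar_op 'i) (c *: X) ('i * c) _ phiP).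
  - by rewrite normrM normCi c1 mulr1.
  - by rewrite triple_anticommutator // AX XA addr0 !scaler0.
  - by rewrite phi_i phiX triple_anticommutator.
  apply: self_adjointZ.
  by rewrite /self_adjoint adjointD !adjointM Asa' Ysa addrC.
move/eqP: comm; rewrite !scaler_eq0 (negPf two0) (negPf (neq0Ci _)) /= subr_eq0.
move/eqP => comm.
move/eqP: anti; rewrite scaler_eq0 (negPf two0) /= -comm -mulr2n -scaler_nat.
by rewrite scaler_eq0 pnatr_eq0 => /eqP.
Qed.

Definition sup_one X := forall s, num_le X s <-> 1 <= s.

(** The rank-one projections, described by notions that a preserver respects: the
    order through [num_le], and products of self-adjoint operators equal to 0. *)
Definition atom A := [/\ self_adjoint A, sup_one A &
  forall B, self_adjoint B -> sup_one B ->
    (forall C, self_adjoint C -> A * C = 0 -> B * C = 0) -> B = A].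

Lemma self_adjoint_rank1 x : self_adjoint (rank1 x x).
Proof. exact: adjoint_rank1. Qed.

Lemma rank1_inner x v : '<rank1 x x v, v> = '<v, x> * Num.conj '<v, x>.
Proof. by rewrite rank1E innerZl -innerC. Qed.

Lemma rnorm_rank1 x v : complex.Re '<rank1 x x v, v> = complex.Re `|'<v, x>| ^+ 2.
Proof.
by rewrite rank1_inner -normCK -Re_norm_real -rmorphXn.
Qed.

Lemma inner_unit x : rnorm x = 1 -> '<x, x> = 1.
Proof. by move=> x1; rewrite -rnorm_sq x1 expr1n. Qed.

Lemma sup_one_rank1 x : rnorm x = 1 -> sup_one (rank1 x x).
Proof.
move=> x1 s; split=> [/(_ x)|s1 v].
  by rewrite rank1_inner inner_unit // rmorph1 mulr1 x1 expr1n mulr1.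
rewrite rnorm_rank1; apply: le_trans (_ : rnorm v ^+ 2 <= _).
  have := Re_norm_inner v x; rewrite x1 mulr1 => le_v.
  by rewrite ler_sqr_nonneg ?rnorm_ge0 // -ler0c Re_norm_real normr_ge0.
by rewrite -[leLHS]mul1r ler_wpM2r ?sqr_ge0.
Qed.

Lemma orthogonal_decomp x v : rnorm x = 1 -> '<v - '<v, x> *: x, x> = 0.
Proof. by move=> x1; rewrite innerDl innerNl innerZl inner_unit // mulr1 subrr. Qed.

(** B vanishes on the orthogonal of x, so it is a multiple of the projection, and
    the normalization makes the factor 1. *)
Lemma sa_eq_rank1 x B : rnorm x = 1 -> self_adjoint B -> sup_one B ->
  (forall y, '<y, x> = 0 -> B y = 0) -> B = rank1 x x.
Proof.
move=> x1 Bsa Bsup By.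
pose b := complex.Re '<B x, x>.
have Bx : B x = b%:C *: x.
  have : '<B x - '<B x, x> *: x, B x - '<B x, x> *: x> = 0.
    set w := _ - _; have wx : '<w, x> = 0 by exact: orthogonal_decomp.
    rewrite {2}/w innerDr innerNr innerZr wx mulr0 subr0.
    by rewrite inner_adjoint Bsa By // inner0l.
  move/inner_eq0/eqP; rewrite subr_eq0 => /eqP {1}->.
  by rewrite -sa_inner_real.
have BE : B = b%:C *: rank1 x x.
  apply: bopP => v; rewrite bopE rank1E -{1}[v](subrK ('<v, x> *: x)).
  by rewrite bopDr By ?orthogonal_decomp // add0r bopZr Bx !scalerA mulrC.
have b1 : b <= 1.
  have /(_ x) := (Bsup 1).2 (lexx 1).
  by rewrite mul1r x1 expr1n.
suff -> : B = 1%:C *: rank1 x x by rewrite scale1r.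
rewrite {1}BE; congr (_%:C *: _); apply/eqP; rewrite eq_le b1 /=.
(* The numerical range of b P lies between 0 and b. *)
have maxb : num_le B (Num.max b 0).
  move=> v; rewrite BE bopE innerZl Re_realM.
  have P0 : 0 <= complex.Re '<rank1 x x v, v>.
    by rewrite rnorm_rank1 sqr_ge0.
  have P1 := (sup_one_rank1 _ x1 1).2 (lexx 1) v; rewrite mul1r in P1.
  apply: le_trans (_ : Num.max b 0 * complex.Re '<rank1 x x v, v> <= _).
    by rewrite ler_wpM2r // le_max lexx.
  by rewrite ler_wpM2l // le_max lexx orbT.
by have := (Bsup _).1 maxb; rewrite le_max (lt_geF ltr01) orbF.
Qed.

Lemma mul_rank1_eq0 B y : B * rank1 y y = 0 -> B y = 0.
Proof.
have [->|y0] := eqVneq y 0; first by rewrite bop0r.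
move=> /(congr1 (fun T : 'B(H) => T y)); rewrite bopE rank1E bopZr bopE.
by move/eqP; rewrite scaler_eq0 dnorm_eq0 (negPf y0) => /eqP.
Qed.

Lemma rank1_mul_orthogonal x y : '<y, x> = 0 -> rank1 x x * rank1 y y = 0.
Proof.
move=> yx; rewrite mul_rank1 rank1E yx scale0r.
by apply: bopP => v; rewrite rank1E scaler0.
Qed.

Lemma atom_rank1 x : rnorm x = 1 -> atom (rank1 x x).
Proof.
move=> x1; split; [exact: self_adjoint_rank1|exact: sup_one_rank1|].
move=> B Bsa Bsup BC; apply: sa_eq_rank1 => // y yx.
apply: mul_rank1_eq0; apply: BC; first exact: self_adjoint_rank1.
exact: rank1_mul_orthogonal.
Qed.

Lemma normalize y : y != 0 -> exists x (k : R), [/\ rnorm x = 1, 0 < k & y = k%:C *: x].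
Proof.
move=> y0; have ny : 0 < rnorm y by rewrite rnorm_gt0.
exists ((rnorm y)^-1%:C *: y), (rnorm y); split=> //.
  by rewrite rnormZ_real ?invr_ge0 ?rnorm_ge0 // mulVf // gt_eqF.
by rewrite scalerA -rmorphM /= mulfV ?gt_eqF // scale1r.
Qed.

(** Any unit vector x in the range of A gives a competitor: A C = 0 implies
    C A = 0, hence C x = 0. By minimality A is the projection onto x. *)
Lemma atom_is_rank1 A : atom A -> exists2 x, rnorm x = 1 & A = rank1 x x.
Proof.
move=> [Asa Asup Amin].
have [z Az] : exists z, A z != 0.
  apply: contrapT => /forallNP A0; have : num_le A 0.
    by move=> v; have /negP := A0 v; rewrite negbK => /eqP->; rewrite inner0l mul0r.
  by move/Asup; rewrite leNgt ltr01.
have [x [k [x1 k0 AzE]]] := normalize _ Az.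
exists x => //; apply/esym/Amin; [exact: self_adjoint_rank1|exact: sup_one_rank1|].
move=> C Csa /(sa_mul0C _ _ Asa Csa) CA; rewrite rank1_mul Csa.
have -> : C x = 0.
  have := congr1 (fun T : 'B(H) => T z) CA; rewrite bopE AzE bopZr bopE.
  by move/eqP; rewrite scaler_eq0 (inj_eq (@complexI _)) gt_eqF //= => /eqP.
by apply: bopP => v; rewrite rank1E inner0r scale0r.
Qed.

Lemma preserver_sup_one phi A : preserver eps phi -> self_adjoint A ->
  sup_one A -> sup_one (phi A).
Proof. by move=> phiP Asa Asup s; rewrite -preserver_num_le. Qed.

Lemma preserver_sa_mul0 phi A C : preserver eps phi -> self_adjoint A ->
  self_adjoint C -> A * C = 0 -> phi A * phi C = 0.
Proof.
move=> phiP Asa Csa; apply: (preserver_mul0 _ _ _ _ 1) => //; rewrite ?normr1 ?scale1r //.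
exact: preserver_sa phiP Csa.
Qed.

Lemma preserver_atom phi A : preserver eps phi -> atom A -> atom (phi A).
Proof.
move=> phiP [Asa Asup Amin]; have [[psi phiK psiK] _] := phiP.
have psiP := preserver_inverse _ _ _ phiK psiK phiP.
split; [exact: (preserver_sa eps0) | exact: preserver_sup_one |].
move=> B Bsa Bsup BC; rewrite -[B]psiK; congr phi; apply: Amin.
- exact: (preserver_sa eps0).
- exact: preserver_sup_one.
move=> C Csa AC; rewrite -[C]phiK; apply: preserver_sa_mul0 => //.
  exact: (preserver_sa eps0).
by apply: BC; [exact: (preserver_sa eps0) | exact: preserver_sa_mul0].
Qed.

Lemma preserver_rank1 phi x : preserver eps phi -> rnorm x = 1 ->
  exists2 x', rnorm x' = 1 & phi (rank1 x x) = rank1 x' x'.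
Proof. by move=> phiP x1; apply/atom_is_rank1/preserver_atom/atom_rank1. Qed.

(** Put phi(i P) = i Q. Then Q is self-adjoint, its numerical range has supremum 1
    because F(1, i P, 1) = 4 i P, and Q vanishes on the orthogonal of x' because
    D P = 0 implies phi(D) Q = 0. So Q is the projection onto x'. *)
Lemma preserver_i_rank1 phi x x' : preserver eps phi -> rnorm x = 1 ->
  rnorm x' = 1 -> phi (rank1 x x) = rank1 x' x' ->
  phi ('i *: rank1 x x) = 'i *: rank1 x' x'.
Proof.
move=> phiP x1 x'1 phix.
have [[psi phiK psiK] _] := phiP.
have psiP := preserver_inverse _ _ _ phiK psiK phiP.
have [phi_1 phi_i] := preserver_1_i eps0 H_neq0 _ phiP.
have ii : ('i : R[i]) * 'i = -1 by rewrite -expr2 sqrCi.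
pose Q := - 'i *: phi ('i *: rank1 x x).
have phiQ : phi ('i *: rank1 x x) = 'i *: Q.
  by rewrite /Q scalerA mulrN ii opprK scale1r.
have Psa := self_adjoint_rank1 x.
have Qsa : self_adjoint Q.
  have sk : adjoint (phi ('i *: rank1 x x)) = - phi ('i *: rank1 x x).
    by apply: preserver_skew => //; rewrite adjointZ conjCi Psa scaleNr.
  by rewrite /self_adjoint /Q adjointZ sk rmorphN /= conjCi opprK scalerN scaleNr.
rewrite phiQ; congr (_ *: _); apply: sa_eq_rank1 => // [s|y yx].
  have := sup_one_rank1 _ x1 s; suff -> : num_le (rank1 x x) s <-> num_le Q s by [].
  have triple_1 X : self_adjoint X -> triple 1 ('i *: X) 1 = ('i * 4%:C) *: X.
    move=> Xsa; rewrite tripleE adjoint1 adjointZ Xsa conjCi.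
    by apply: bop_ext => u v; rewrite !(bopE, bop_linE, innerE); ring.
  apply: (preserver_num eps0 _ 1 ('i *: rank1 x x) 1 'i 4 _ _ phiP) => //.
  - exact: normCi.
  - exact: triple_1.
  by rewrite phi_1 phiQ triple_1.
have ysa := self_adjoint_rank1 y.
apply: mul_rank1_eq0; apply: sa_mul0C => //.
rewrite -[rank1 y y]psiK.
apply: (preserver_mul0 _ _ (rank1 x x) _ 'i phiP) => //.
- exact: (preserver_sa eps0).
- exact: normCi.
apply: sa_mul0C => //; first exact: (preserver_sa eps0).
rewrite -[rank1 x x]phiK; apply: preserver_sa_mul0 => //.
  by rewrite phix; exact: self_adjoint_rank1.
by rewrite phix rank1_mul_orthogonal.
Qed.

End RankOne.

(** * Preservers and quadratic forms *)

Section Quadratic.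
Context {R : realType} {H : hilbertType R}.
Implicit Types (x y z u v w e : H) (S T A B C D Q X Y : 'B(H)).
Implicit Types (a b c l : R[i]) (s t k eps : R) (phi psi : 'B(H) -> 'B(H)).

Definition sym_op u x := rank1 u x + rank1 x u.

Lemma self_adjoint_sym u x : self_adjoint (sym_op u x).
Proof. by rewrite /self_adjoint /sym_op adjointD !adjoint_rank1 addrC. Qed.

Lemma sym_opN u x : sym_op (- u) x = - sym_op u x.
Proof.
by apply: bop_ext => v w; rewrite /sym_op !(bopE, rank1E, innerE); ring.
Qed.

Lemma Re_sym_op u x v :
  complex.Re '<sym_op u x v, v> = 2 * complex.Re ('<v, x> * '<u, v>).
Proof.
rewrite /sym_op bopDE !rank1E !innerE raddfD /=.
have -> : complex.Re ('<v, u> * '<x, v>) = complex.Re ('<v, x> * '<u, v>).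
  by rewrite -Re_conj rmorphM /= -!innerC mulrC.
by ring.
Qed.

(** For a unit vector v, the reflection 2 <x, v> v - x of x has norm 1, so the real
    part of its inner product with u is at most |u| (the argument of Buzano's
    inequality). The proof uses a multiple of it, to allow any v. *)
Lemma sym_op_le u x (al : R) : rnorm x = 1 -> '<u, x> = al%:C ->
  num_le (sym_op u x) (al + rnorm u).
Proof.
move=> x1 ux v; rewrite Re_sym_op.
pose w := (2%:C * '<x, v>) *: v - '<v, v> *: x.
have ww : rnorm w = rnorm v ^+ 2.
  apply/eqP; rewrite -(eqrXn2 (n := 2)) ?rnorm_ge0 ?sqr_ge0 //; apply/eqP.
  apply: (@complexI R); rewrite [RHS]rmorphXn /= !rnorm_sq.
  rewrite /w !innerE (inner_unit _ x1) !rmorphM /= -!innerC conjCr.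
  by ring.
have := Re_CauchySchwarz u w.
have -> : '<u, w> = 2%:C * ('<v, x> * '<u, v>) - (rnorm v ^+ 2 * al)%:C.
  rewrite /w !innerE rmorphM /= conjCr -!innerC ux rmorphM /= -rnorm_sq.
  by ring.
by rewrite raddfB /= Re_realM ww; lra.
Qed.

Context (orth : forall x, rnorm x = 1 -> exists2 y, y != 0 & '<y, x> = 0).

(** The bound of [sym_op_le] is attained: at v = |u| x + u when al + |u| > 0, and
    at any vector orthogonal to x when al + |u| = 0. *)
Lemma sym_op_leP u x (al : R) s : rnorm x = 1 -> '<u, x> = al%:C ->
  num_le (sym_op u x) s <-> al + rnorm u <= s.
Proof.
move=> x1 ux; split=> [us|als v]; last first.
  by apply: le_trans (sym_op_le _ _ _ x1 ux v) _; rewrite ler_wpM2r ?sqr_ge0.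
set n := rnorm u; have n0 : 0 <= n by exact: rnorm_ge0.
have : 0 <= al + n.
  have := Re_CauchySchwarz (- u) x.
  by rewrite innerNl ux raddfN /= rnormN x1 mulr1 -/n; lra.
rewrite le_eqVlt => /orP[/eqP<-|an0].
  have [y y0 yx] := orth _ x1; have := us y.
  by rewrite Re_sym_op yx mul0r mulr0 pmulr_lge0 // exprn_gt0 // rnorm_gt0.
have {}n0 : 0 < n.
  rewrite lt_def n0 andbT; apply/eqP => n00; move: an0; rewrite n00 addr0.
  move/eqP: n00; rewrite rnorm_eq0 => /eqP u0; move: ux; rewrite u0 inner0l.
  by move=> /(congr1 (@complex.Re R)) /= <-; rewrite ltxx.
have := us (n%:C *: x + u).
rewrite Re_sym_op rnorm_sqD rnormZ_real ?(ltW n0) // x1 -/n.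
have -> : '<n%:C *: x + u, x> * '<u, n%:C *: x + u> = ((n + al) * (n * (al + n)))%:C.
  rewrite !innerE conjCr (inner_unit _ x1) ux -rnorm_sq -/n !rmorphM !rmorphD /=.
  by ring.
have -> : '<n%:C *: x, u> = (n * al)%:C.
  by rewrite innerZl innerC ux conjCr -rmorphM.
rewrite /= => le_s; rewrite -(ler_pM2r (mulr_gt0 n0 an0)).
by clear -le_s; nra.
Qed.

(** Adding to u an imaginary multiple of x leaves [sym_op u x] unchanged; this
    reduces the computation of its numerical range to real <u, x>. *)
Lemma imaginary_shift u x : rnorm x = 1 ->
  exists2 u0, '<u0, x> = (complex.Re '<u, x>)%:C &
    sym_op u0 x = sym_op u x /\
    rnorm u ^+ 2 = rnorm u0 ^+ 2 +
      complex.Re `|'<u, x> - (complex.Re '<u, x>)%:C| ^+ 2.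
Proof.
move=> x1; set z := '<u, x>; set d := z - _.
have dconj : Num.conj d = - d.
  by rewrite /d; case: (z) => p q; rewrite /Num.conj /=; apply/eqP;
    rewrite eq_complex /= !subr0 subrr oppr0 !eqxx.
have u0x : '<u - d *: x, x> = (complex.Re z)%:C.
  by rewrite !innerE (inner_unit _ x1) mulr1 -/z /d opprB addrC subrK.
exists (u - d *: x) => //; split.
  apply: bop_ext => v w; rewrite /sym_op !(bopE, rank1E, innerE) dconj.
  by ring.
rewrite -{1}[u](subrK (d *: x)) [LHS]rnorm_sqD rnormZ x1 mulr1 innerZr u0x dconj.
rewrite [- d * _]mulrC Re_realM raddfN /= [complex.Re d]raddfB /= subrr oppr0 mulr0 mulr0.
by rewrite addr0.
Qed.

Context {eps : R} (eps0 : 0 < eps).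
Context (H_neq0 : (1 : 'B(H)) != 0).

(** The suprema of the numerical ranges of [sym_op u x] and of its opposite are
    al + |u| and - al + |u|, and they determine al and |u|. *)
Lemma preserver_sym phi A B C c k u x u' x' (al al' : R) :
  preserver eps phi -> `|c| = 1 -> 0 < k -> rnorm x = 1 -> rnorm x' = 1 ->
  '<u, x> = al%:C -> '<u', x'> = al'%:C ->
  triple A B C = (c * k%:C) *: sym_op u x ->
  triple (phi A) (phi B) (phi C) = (c * k%:C) *: sym_op u' x' ->
  al = al' /\ rnorm u = rnorm u'.
Proof.
move=> phiP c1 k0 x1 x'1 ux u'x' tE tE'.
have sup_eq (p q : R) : (forall s, p <= s <-> q <= s) -> p = q.
  by move=> pq; apply/eqP; rewrite eq_le (pq q).2 // (pq p).1.
have e1 : al + rnorm u = al' + rnorm u'.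
  apply: sup_eq => s; rewrite -(sym_op_leP _ _ _ _ x1 ux) -(sym_op_leP _ _ _ _ x'1 u'x').
  by apply: (preserver_num eps0 _ _ _ _ _ _ _ _ phiP c1 k0 tE tE');
    exact: self_adjoint_sym.
have e2 : - al + rnorm u = - al' + rnorm u'.
  apply: sup_eq => s; rewrite -(rnormN u) -(rnormN u').
  have nux : '<- u, x> = (- al)%:C by rewrite innerNl ux rmorphN.
  have nu'x' : '<- u', x'> = (- al')%:C by rewrite innerNl u'x' rmorphN.
  rewrite -(sym_op_leP _ _ _ _ x1 nux) -(sym_op_leP _ _ _ _ x'1 nu'x').
  apply: (preserver_num eps0 _ A B C (- c) k _ _ phiP) => //;
    try exact: self_adjoint_sym.
  - by rewrite normrN.
  - by rewrite tE sym_opN mulNr scaleNr scalerN opprK.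
  by rewrite tE' sym_opN mulNr scaleNr scalerN opprK.
by split; lra.
Qed.

Lemma triple_i_rank1 A x :
  triple A ('i *: rank1 x x) 1 = ('i * 2%:C) *: sym_op (A x) x.
Proof.
rewrite tripleE adjointZ adjoint_rank1 conjCi.
apply: bop_ext => v w; rewrite /sym_op.
rewrite !(bopE, bop_linE, rank1E, innerE). rewrite ?inner_adjoint.
by ring.
Qed.

Lemma triple_rank1 A x :
  triple (rank1 x x) A 1 =
  ('i * 1%:C) *: sym_op ((- 'i *: (A - adjoint A)) x) x.
Proof.
rewrite tripleE adjoint_rank1.
have ii : ('i : R[i]) * 'i = -1 by rewrite -expr2 sqrCi.
apply: bop_ext => v w; rewrite /sym_op !(bopE, bop_linE, rank1E, innerE).
rewrite rmorphN /= conjCi -adjointP !inner_adjoint.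
transitivity (- ('i * 'i) * ('<A v, x> * '<x, w> + '<v, x> * '<A x, w> -
  ('<v, x> * '<adjoint A x, w> + '<adjoint A v, x> * '<x, w>))).
  by rewrite ii; ring.
by ring.
Qed.

(** F(A, i P, 1) gives Re <A x, x> and the norm of A x up to the contribution of
    Im <A x, x>, which is given by F(P, A, 1). *)
Lemma preserver_quadratic phi A x x' : preserver eps phi ->
  rnorm x = 1 -> rnorm x' = 1 -> phi (rank1 x x) = rank1 x' x' ->
  '<phi A x', x'> = '<A x, x> /\ rnorm (phi A x') = rnorm (A x).
Proof.
move=> phiP x1 x'1 phix.
have phi_ix := preserver_i_rank1 eps0 H_neq0 _ _ _ phiP x1 x'1 phix.
have [phi_1 _] := preserver_1_i eps0 H_neq0 _ phiP.
have i1 := @normCi R[i].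
have [u ux [uA nu]] := imaginary_shift (A x) _ x1.
have [u' ux' [uA' nu']] := imaginary_shift (phi A x') _ x'1.
have [reE nE] : complex.Re '<A x, x> = complex.Re '<phi A x', x'> /\
    rnorm u = rnorm u'.
  apply: (preserver_sym _ A ('i *: rank1 x x) 1 'i 2 u x u' x' _ _ phiP) => //.
    by rewrite uA triple_i_rank1.
  by rewrite uA' phi_1 phi_ix triple_i_rank1.
have ImE (B : 'B(H)) v : '<(- 'i *: (B - adjoint B)) v, v> =
    (2 * complex.Im '<B v, v>)%:C.
  rewrite !(bopE, innerE) -inner_adjoint (innerC v) -complexiE.
  by case: '<B v, v> => p q; apply/eqP; rewrite eq_complex /=;
    apply/andP; split; apply/eqP; ring.
have [imE _] : 2 * complex.Im '<A x, x> = 2 * complex.Im '<phi A x', x'> /\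
    rnorm ((- 'i *: (A - adjoint A)) x) =
    rnorm ((- 'i *: (phi A - adjoint (phi A))) x').
  apply: (preserver_sym _ (rank1 x x) A 1 'i 1 _ x _ x' _ _ phiP) => //.
    exact: triple_rank1.
  by rewrite phix phi_1 triple_rank1.
have zE : '<phi A x', x'> = '<A x, x>.
  have {}imE : complex.Im '<A x, x> = complex.Im '<phi A x', x'> by lra.
  by apply/eqP; rewrite eq_complex reE imE !eqxx.
split=> //; apply/eqP; rewrite -(eqrXn2 (n := 2)) ?rnorm_ge0 //.
by rewrite nu nu' nE zE.
Qed.
End Quadratic.

(** * From a *-automorphism to a unitary *)

Section StarMorphism.
Context {R : realType} {H : hilbertType R}.
Implicit Types (x y z u v w e : H) (S T A B C D Q X Y : 'B(H)).
Implicit Types (a b c l : R[i]) (s t k eps : R) (phi psi : 'B(H) -> 'B(H)).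
Context {phi : 'B(H) -> 'B(H)}.
Context (transfer : forall y, exists x, forall A,
  '<phi A y, y> = '<A x, x> /\ rnorm (phi A y) = rnorm (A x)).

Lemma transferD A B : phi (A + B) = phi A + phi B.
Proof.
apply: bop_quadratic_ext => y; have [x xE] := transfer y.
by rewrite !bopDE !innerDl !(xE _).1 bopDE innerDl.
Qed.

Lemma transferZ a A : phi (a *: A) = a *: phi A.
Proof.
apply: bop_quadratic_ext => y; have [x xE] := transfer y.
by rewrite !bopZE !innerZl !(xE _).1 bopZE innerZl.
Qed.

Lemma transfer_adjoint A : phi (adjoint A) = adjoint (phi A).
Proof.
apply: bop_quadratic_ext => y; have [x xE] := transfer y.
by rewrite (xE _).1 -!inner_adjoint innerC -(xE _).1 -innerC.
Qed.

(** This is where the equality of norms enters: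
    |phi(A) y|^2 = |A x|^2 = <(adj A) A x, x>. *)
Lemma transfer_square A : phi (adjoint A * A) = adjoint (phi A) * phi A.
Proof.
apply: bop_quadratic_ext => y; have [x xE] := transfer y.
by rewrite (xE _).1 !bopE -!inner_adjoint -!rnorm_sq (xE A).2.
Qed.

(** Polarization of the previous lemma at A + B and A + i B. *)
Lemma transferM_adjoint A B : phi (adjoint A * B) = adjoint (phi A) * phi B.
Proof.
have := transfer_square (A + B); have := transfer_square (A + 'i *: B).
rewrite !(adjointD, adjointZ, mulrDl, mulrDr, transferD, transferZ).
rewrite !(bop_scalerAl, bop_scalerAr) ?(transferD, transferZ).
rewrite !transfer_square conjCi => e1 e2.
apply: bop_ext => x y.
have e0 (T S : 'B(H)) : T = S -> '<T x, y> - '<S x, y> = 0 by move=> ->; rewrite subrr.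
move: (e0 _ _ e1) (e0 _ _ e2); rewrite !(bopE, innerE) => {}e1 {}e2.
have ii : ('i : R[i]) * 'i = -1 by rewrite -expr2 sqrCi.
apply: (@mulfI _ 2); first by rewrite pnatr_eq0.
apply/eqP; rewrite -subr_eq0; apply/eqP.
transitivity ((0 - 'i * 0 : R[i]) + (('i : R[i]) * 'i + 1) *
  ('<phi (adjoint A * B) x, y> - '<adjoint (phi A) (phi B x), y> -
   ('<phi (adjoint B * A) x, y> - '<adjoint (phi B) (phi A x), y>))).
  by rewrite -{1}e2 -e1; ring.
by rewrite ii; ring.
Qed.

Lemma transferM A B : phi (A * B) = phi A * phi B.
Proof. by rewrite -{1}[A]adjointK transferM_adjoint transfer_adjoint adjointK. Qed.
End StarMorphism.

Section Main.
Context {R : realType} {H : hilbertType R}.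
Implicit Types (x y z u v w e : H) (S T A B C D Q X Y : 'B(H)).
Implicit Types (a b c l : R[i]) (s t k eps : R) (phi psi : 'B(H) -> 'B(H)).

Lemma infinite_dimensional_orth : infinite_dimensional H ->
  forall x, rnorm x = 1 -> exists2 y, y != 0 & '<y, x> = 0.
Proof.
move=> Hinf x x1; apply: contrapT => noy; apply: (Hinf [:: x]).
apply/seteqP; split=> // z _; exists [:: x], (fun=> '<z, x>); split=> //.
rewrite big_seq1; apply/eqP; rewrite -subr_eq0; apply: contrapT => /negP z0.
by apply: noy; exists (z - '<z, x> *: x) => //; apply: orthogonal_decomp.
Qed.

Lemma infinite_dimensional_neq0 : infinite_dimensional H -> (1 : 'B(H)) != 0.
Proof.
move=> Hinf; apply/eqP => one0; apply: (Hinf [::]).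
apply/seteqP; split=> // z _; exists [::], (fun=> 0); split=> //.
by rewrite big_nil -[z]bop1E one0.
Qed.

(** The inverse of phi is a preserver too, so every line is that of some x'. *)
Lemma preserver_transfer eps phi : 0 < eps -> infinite_dimensional H ->
  preserver eps phi -> forall y, exists x, forall A,
  '<phi A y, y> = '<A x, x> /\ rnorm (phi A y) = rnorm (A x).
Proof.
move=> eps0 Hinf phiP y.
have H_neq0 := infinite_dimensional_neq0 Hinf.
have orth := infinite_dimensional_orth Hinf.
have [->|y0] := eqVneq y 0.
  by exists 0 => A; rewrite !bop0r !inner0r.
have [y1 [k [y11 k0 ->]]] := normalize _ y0.
have [[psi phiK psiK] _] := phiP.
have psiP := preserver_inverse _ _ _ phiK psiK phiP.
have [x x1 xE] := preserver_rank1 eps0 H_neq0 _ _ psiP y11.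
exists (k%:C *: x) => A.
have phix : phi (rank1 x x) = rank1 y1 y1 by rewrite -xE psiK.
have [eq1 eq2] := preserver_quadratic orth eps0 H_neq0 _ A _ _ phiP x1 y11 phix.
by rewrite !bopZr !innerE eq1 !rnormZ_real ?(ltW k0) // eq2.
Qed.

(** The unitary is U v = phi (v (x) e) e'. It is isometric because
    (e (x) v)(v (x) e) = |v|^2 e (x) e, it intertwines because
    A (v (x) e) = A v (x) e, and it is onto because phi is: if
    phi(B) = y (x) e', then U (B e) = y. *)
Lemma star_automorphism_spatial phi e e' :
  (forall A B, phi (A + B) = phi A + phi B) ->
  (forall a A, phi (a *: A) = a *: phi A) ->
  (forall A, phi (adjoint A) = adjoint (phi A)) ->
  (forall A B, phi (A * B) = phi A * phi B) ->
  (forall B, exists A, phi A = B) ->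
  rnorm e = 1 -> rnorm e' = 1 -> phi (rank1 e e) = rank1 e' e' ->
  exists2 U, unitary U & forall A, phi A = U * A * adjoint U.
Proof.
move=> phiD phiZ phiS phiM phi_surj e1 e'1 phie.
pose f v := phi (rank1 v e) e'.
have f_lin : linear f.
  move=> a u v; rewrite /f.
  have -> : rank1 (a *: u + v) e = a *: rank1 u e + rank1 v e.
    by apply: bop_ext => x y; rewrite !(bopE, rank1E, innerE); ring.
  by rewrite phiD phiZ !bopE.
have f_iso v : '<f v, f v> = '<v, v>.
  rewrite /f inner_adjoint -bopME -phiS -phiM adjoint_rank1 mul_rank1 rank1E.
  have -> : rank1 ('<v, v> *: e) e = '<v, v> *: rank1 e e.
    by apply: bop_ext => x y; rewrite !(bopE, rank1E, innerE); ring.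
  rewrite phiZ phie bopE rank1E innerZl (inner_unit _ e'1) scale1r.
  by rewrite (inner_unit _ e'1) mulr1.
have f_bnd : bounded_map f.
  exists 1 => // v; rewrite mul1r -ler_sqr_nonneg ?rnorm_ge0 // !rnorm_sqE f_iso.
  exact: lexx.
pose U : 'B(H) := BOp f_lin f_bnd.
have UE v : U v = phi (rank1 v e) e' by [].
have U1 : adjoint U * U = 1.
  by apply: bop_quadratic_ext => v; rewrite !bopE -inner_adjoint f_iso.
have intertwine A : phi A * U = U * A.
  by apply: bopP => v; rewrite !bopE !UE -bopME -phiM mul_rank1.
have U2 : U * adjoint U = 1.
  apply: bopP => y; rewrite !bopE.
  have [B BE] := phi_surj (rank1 y e').
  have -> : y = U (B e).
    have := intertwine B; move=> /(congr1 (fun T : 'B(H) => T e)); rewrite !bopE => <-.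
    by rewrite BE UE phie !rank1E (inner_unit _ e'1) scale1r (inner_unit _ e'1) scale1r.
  by rewrite -[adjoint U (U _)]bopME U1.
by exists U => // A; rewrite -intertwine -mulrA U2 mulr1.
Qed.

End Main.

Theorem theorem2p1 (R : realType) (H : hilbertType R)
    (Hinf : infinite_dimensional H)
    (E : set H) (Ebasis : orthonormal_basis E) (J : basis_conj E)
    (eps : R) (eps_gt0 : 0 < eps)
    (phi : 'B(H) -> 'B(H)) (phi_bij : bijective phi)
    (phi_pseudo : forall T1 T2 T3 : 'B(H),
      pseudospectrum eps (skew_lie (jordan_star T1 T2) T3) =
      pseudospectrum eps
        (skew_lie (jordan_star (phi T1) (phi T2)) (phi T3))) :
  exists S U : 'B(H),
    bop_invertible S /\ unitary U /\
    ((forall T : 'B(H), phi T = S * U * T * adjoint U) \/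
     (forall T : 'B(H), phi T = S * U * transpose J T * adjoint U)).
Proof.
have phiP : preserver eps phi by split.
have H_neq0 := infinite_dimensional_neq0 Hinf.
have transfer := preserver_transfer _ _ eps_gt0 Hinf phiP.
have [v v0] : exists v : H, v != 0.
  apply: contrapT => /forallNP v0; move/eqP: H_neq0; apply; apply: bopP => v.
  by have /negP := v0 v; rewrite negbK => /eqP.
have [e [_ [e1 _ _]]] := normalize _ v0.
have [e' e'1 phie] := preserver_rank1 eps_gt0 H_neq0 _ _ phiP e1.
have [U Uu phiU] := star_automorphism_spatial _ _ _ (transferD transfer)
  (transferZ transfer) (transfer_adjoint transfer) (transferM transfer)
  (preserver_surj _ _ phiP) e1 e'1 phie.
exists 1, U; split; first by exists 1; rewrite mulr1.
by split=> //; left => T; rewrite mul1r.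
Qed.
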